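(* Let $\mathcal{A}$ be a unital MF C*-algebra and let $\{x_1,\dots,x_n,y_1,\dots,y_m\}$ be a family of self-adjoint elements generating $\mathcal{A}$. Then $$\mathfrak{K}_{top}^{(2)}(x_1,\dots,x_n:y_1,\dots,y_m)\le \sup_{\tau\in\mathcal{T}_{MF}(\mathcal{A})}\mathfrak{K}_2^{(2)}(x_1,\dots,x_n:y_1,\dots,y_m;\tau),$$ where $\mathcal{T}_{MF}(\mathcal{A})$ is the set of all MF-traces on $\mathcal{A}$.
   Context: MF algebras and MF-traces: a C*-algebra is MF if it embeds into $\prod_k \mathcal{M}_{m_k}(\mathbb{C})/\sum_k \mathcal{M}_{m_k}(\mathbb{C})$ for some increasing sequence $\{m_k\}$ of positive integers. For an MF algebra $\mathcal{A}=C^*(z_1,\dots,z_N)$, a tracial state $\tau$ is an MF-trace if there are positive integers $m_k$ and matrices $A_{1k},\dots,A_{Nk}\in\mathcal{M}_{m_k}(\mathbb{C})$ ($k\ge 1$) such that for every $*$-polynomial $Q$, $\lim_k\|Q(A_{1k},\dots,A_{Nk})\|=\|Q(z_1,\dots,z_N)\|$ and $\lim_k\tau_{m_k}(Q(A_{1k},\dots,A_{Nk}))=\tau(Q(z_1,\dots,z_N))$. Orbit covering numbers: $\tau_k$ is the normalized trace on $\mathcal{M}_k(\mathbb{C})$, $\mathcal{M}_k^{s.a}(\mathbb{C})$ the self-adjoint matrices, $\mathcal{U}(k)$ the unitary group, $\|(A_1,\dots,A_n)\|_2=(\sum_i\tau_k(A_i^*A_i))^{1/2}$. For $\Sigma\subseteq\mathcal{M}_k(\mathbb{C})^n$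 and $\omega>0$, $o_2(\Sigma,\omega)$ is the minimal number of $\omega$-orbit-$\|\cdot\|_2$-balls with centers in $\Sigma$ whose union contains $\Sigma$; the $\omega$-orbit-$\|\cdot\|_2$-ball centered at $(B_1,\dots,B_n)$ is the set of $(A_1,\dots,A_n)$ for which some $W\in\mathcal{U}(k)$ satisfies $\|(A_1,\dots,A_n)-(WB_1W^*,\dots,WB_nW^* )\|_2<\omega$. Topological orbit dimension: let $P_1,P_2,\dots$ enumerate all noncommutative polynomials in $n+m$ indeterminates with coefficients in $\mathbb{Q}+i\mathbb{Q}$ (constants included). $\Gamma_R^{(top)}(x_1,\dots,x_n:y_1,\dots,y_m;k,\varepsilon,P_1,\dots,P_r)$ is the set of $(A_1,\dots,A_n)\in(\mathcal{M}_k^{s.a}(\mathbb{C}))^n$ for which there exist $B_1,\dots,B_m\in\mathcal{M}_k^{s.a}(\mathbb{C})$ such that all $\|A_i\|,\|B_j\|\le R$ and $\big|\|P_j(A_1,\dots,A_n,B_1,\dots,B_m)\|-\|P_j(x_1,\dots,x_n,y_1,\dots,y_m)\|\big|\le\varepsilon$ for $1\le j\le r$. Define $$\mathfrak{K}_{top}^{(2)}(x_1,\dots,x_n:y_1,\dots,y_m)=\sup_{\omega>0}\sup_{R>0}\inf_{\varepsilon>0,r\in\mathbb{N}}\limsup_{k\to\infty}\frac{\log o_2(\Gamma_R^{(top)}(x_1,\dots,x_n:y_1,\dots,y_m;k,\varepsilon,P_1,\dots,P_r),\omega)}{k^2}.$$ Modified free orbit dimension: for a tracial state $\tau$, $\Gamma_R(x_1,\dots,x_n:y_1,\dots,y_m;p,k,\varepsilon;\tau)$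 is the set of $(A_1,\dots,A_n)\in(\mathcal{M}_k^{s.a}(\mathbb{C}))^n$ for which there exist $A_{n+1},\dots,A_{n+m}\in\mathcal{M}_k^{s.a}(\mathbb{C})$ such that all $\|A_i\|\le R$ and $|\tau_k(A_{i_1}\cdots A_{i_q})-\tau(z_{i_1}\cdots z_{i_q})|<\varepsilon$ for all $1\le q\le p$ and $1\le i_1,\dots,i_q\le n+m$, where $(z_1,\dots,z_{n+m})=(x_1,\dots,x_n,y_1,\dots,y_m)$. Define $$\mathfrak{K}_2^{(2)}(x_1,\dots,x_n:y_1,\dots,y_m;\tau)=\limsup_{\omega\to0^+}\sup_{R>0}\inf_{p\in\mathbb{N},\varepsilon>0}\limsup_{k\to\infty}\frac{\log o_2(\Gamma_R(x_1,\dots,x_n:y_1,\dots,y_m;p,k,\varepsilon;\tau),\omega)}{k^2},$$ with $\log 0=-\infty$. *)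

(* Defs.v *)
From HB Require Import structures.
From mathcomp Require Import all_boot all_order all_algebra.
From mathcomp Require Import all_classical all_reals all_analysis.
From mathcomp Require Import complex ring.
From mathcomp Require Import -(notations) monalg.

Set Implicit Arguments.
Unset Strict Implicit.
Unset Printing Implicit Defensive.

Import Order.TTheory GRing.Theory Num.Theory.
Import numFieldNormedType.Exports.
Local Open Scope classical_set_scope.
Local Open Scope ring_scope.
Local Open Scope sesquilinear_scope.

Notation normc := ComplexField.Normc.normc.

HB.mixin Record isStarAlgebra (R : realType) (A : Type)
    of GRing.Algebra R[i] A := {
  star : A -> A;
  starD : {morph star : a b / a + b};
  starZ : forall (c : R[i]) (a : A), star (c *: a) = c^* *: star a;
  starM : forall a b : A, star (a * b) = star b * star a;
  starK : involutive star
}.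

#[short(type="starAlgType")]
HB.structure Definition StarAlgebra (R : realType) :=
  { A of isStarAlgebra R A & GRing.Algebra R[i] A }.

(* The norm is a field of the structure: the library has no join of its
   normed modules with noncommutative rings.  As [algType] excludes the
   zero ring, C*-algebras are nonzero here. *)
HB.mixin Record isCStarAlgebra (R : realType) (A : Type)
    of StarAlgebra R A := {
  cnorm : A -> R;
  cnorm_eq0 : forall a : A, cnorm a = 0 -> a = 0;
  cnormD_le : forall a b : A, cnorm (a + b) <= cnorm a + cnorm b;
  cnormZ : forall (c : R[i]) (a : A), cnorm (c *: a) = normc c * cnorm a;
  cnormM_le : forall a b : A, cnorm (a * b) <= cnorm a * cnorm b;
  cnorm_starM : forall a : A, cnorm (star a * a) = cnorm a ^+ 2;
  cnorm_complete : forall u : nat -> A,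
    (forall e : R, 0 < e -> exists N : nat,
       forall i j : nat, (N <= i)%N -> (N <= j)%N -> cnorm (u i - u j) < e) ->
    exists l : A, cnorm (u k - l) @[k --> \oo] --> (0 : R)
}.

#[short(type="cstarAlgType")]
HB.structure Definition CStarAlgebra (R : realType) :=
  { A of isCStarAlgebra R A & StarAlgebra R A }.

Definition selfadjoint (R : realType) (A : starAlgType R) (a : A) : Prop :=
  star a = a.

Definition norm_closed (R : realType) (A : cstarAlgType R) (S : set A) : Prop :=
  forall (u : nat -> A) (l : A), (forall k, S (u k)) ->
    cnorm (u k - l) @[k --> \oo] --> (0 : R) -> S l.

(* No proper norm-closed unital *-subalgebra contains all the [z i]. *)
Definition generates (R : realType) (A : cstarAlgType R) (I : Type)
    (z : I -> A) : Prop :=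
  forall S : set A, subalg_closed (mem S) -> (forall a, S a -> S (star a)) ->
    norm_closed S -> (forall i, S (z i)) -> S = setT.

Section MatrixStar.
Variables (R : realType) (k : nat).
Implicit Types A B : 'M[R[i]]_k.+1.

Definition mxstar A : 'M[R[i]]_k.+1 := A ^t*.

Lemma mxstarD : {morph mxstar : A B / A + B}.
Proof. by move=> A B; rewrite /mxstar linearD /= map_mxD. Qed.

Lemma mxstarZ (c : R[i]) A : mxstar (c *: A) = c^* *: mxstar A.
Proof. by rewrite /mxstar linearZ /= map_mxZ. Qed.

Lemma mxstarM A B : mxstar (A * B) = mxstar B * mxstar A.
Proof. by rewrite /mxstar trmx_mul map_mxM. Qed.

Lemma mxstarK : involutive mxstar.
Proof. by move=> A; rewrite /mxstar trmxCK. Qed.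

HB.instance Definition _ := @isStarAlgebra.Build R 'M[R[i]]_k.+1
  mxstar mxstarD mxstarZ mxstarM mxstarK.

End MatrixStar.

(* Noncommutative polynomials over [R[i]] : the monoid algebra of the free
   monoid on [I]. *)
Definition ncpoly (R : realType) (I : choiceType) := malg (fmonom I) R[i].

Definition nceval (R : realType) (I : choiceType) (A : algType R[i])
    (z : I -> A) (P : ncpoly R I) : A :=
  mmap (in_alg A) (fun w : fmonom I => \prod_(i <- w) z i) P.

(* The letter [(i, false)] stands for z_i and [(i, true)] for z_i^*. *)
Definition starpoly (R : realType) (I : choiceType) :=
  ncpoly R (I * bool)%type.

Definition stareval (R : realType) (I : choiceType) (A : starAlgType R)
    (z : I -> A) (Q : starpoly R I) : A :=
  nceval (fun ib : I * bool => if ib.2 then star (z ib.1) else z ib.1) Q.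

Definition gaussian_rational (R : realType) (c : R[i]) : Prop :=
  exists a b : rat, c = Complex (ratr a) (ratr b).

(* Repetitions are allowed. *)
Definition enumerates_rational_ncpoly (R : realType) (I : choiceType)
    (P : nat -> ncpoly R I) : Prop :=
  range P =
  [set p | forall w : fmonom I, gaussian_rational (mcoeff w p)].

Section OperatorNorm.
Variable R : realType.

Definition l2norm n (v : 'cV[R[i]]_n) : R :=
  Num.sqrt (\sum_i normc (v i 0) ^+ 2).

Definition opnorm n (A : 'M[R[i]]_n) : R :=
  sup [set l2norm (A *m v) | v in [set v : 'cV[R[i]]_n | l2norm v <= 1]].

Lemma normc_ge0 (c : R[i]) : 0 <= normc c.
Proof. by case: c => a b; exact: sqrtr_ge0. Qed.

Lemma normc_conj (c : R[i]) : normc c^* = normc c.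
Proof. by case: c => a b; rewrite /= sqrrN. Qed.

Lemma normcJM (c : R[i]) : c^* * c = (normc c ^+ 2)%:C%C.
Proof.
case: c => a b; apply/eqP; rewrite eq_complex /=; apply/andP; split; apply/eqP.
  by rewrite sqr_sqrtr ?addr_ge0 ?sqr_ge0 // mulNr opprK -!expr2.
by rewrite mulNr mulrC subrr.
Qed.

Lemma normc_real (x : R) : 0 <= x -> normc x%:C%C = x.
Proof. by move=> x0; rewrite /= expr0n /= addr0 sqrtr_sqr ger0_norm. Qed.

Lemma le_normc_sum I (r : seq I) (F : I -> R[i]) :
  normc (\sum_(i <- r) F i) <= \sum_(i <- r) normc (F i).
Proof.
elim/big_ind2 : _ => //; first by rewrite ComplexField.Normc.normc0.
by move=> x1 x2 y1 y2 h1 h2; apply: (le_trans (le_normcD _ _)); exact: lerD.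
Qed.

Lemma sum_sqr_ge0 n (a : 'I_n -> R) : 0 <= \sum_i a i ^+ 2.
Proof. by apply: sumr_ge0 => i _; exact: sqr_ge0. Qed.

Lemma cauchy_schwarz_sum n (a b : 'I_n -> R) :
  \sum_i a i * b i <=
  Num.sqrt (\sum_i a i ^+ 2) * Num.sqrt (\sum_i b i ^+ 2).
Proof.
set X := \sum_i a i ^+ 2; set Y := \sum_i b i ^+ 2; set P := \sum_i a i * b i.
have X0 : 0 <= X := sum_sqr_ge0 a.
have Y0 : 0 <= Y := sum_sqr_ge0 b.
suff PXY : P ^+ 2 <= X * Y.
  rewrite -sqrtrM //; apply: (le_trans (ler_norm P)).
  by rewrite -sqrtr_sqr ler_sqrt // mulr_ge0.
have [Y_eq0|Y_neq0] := eqVneq Y 0.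
  have b0 i : b i = 0.
    apply/eqP; rewrite -sqrf_eq0; apply/eqP.
    have /psumr_eq0P H : forall i, true -> 0 <= b i ^+ 2.
      by move=> j _; exact: sqr_ge0.
    exact: H.
  rewrite (_ : P = 0) ?expr0n ?mulr_ge0 //.
  by rewrite /P big1 // => i _; rewrite b0 mulr0.
have Ypos : 0 < Y by rewrite lt_def Y_neq0.
have : 0 <= \sum_i (Y * a i - P * b i) ^+ 2 := sum_sqr_ge0 _.
have -> : \sum_i (Y * a i - P * b i) ^+ 2 = Y * (X * Y - P ^+ 2).
  rewrite (eq_bigr (fun i => Y ^+ 2 * a i ^+ 2 +
    - (2%:R * Y * P) * (a i * b i) + P ^+ 2 * b i ^+ 2)); last first.
    by move=> i _; ring.
  by rewrite !big_split /= -!mulr_sumr -/X -/P -/Y; ring.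
by rewrite pmulr_rge0 // subr_ge0.
Qed.

Lemma l2norm_ge0 n (v : 'cV[R[i]]_n) : 0 <= l2norm v.
Proof. exact: sqrtr_ge0. Qed.

Lemma sqr_l2norm n (v : 'cV[R[i]]_n) :
  l2norm v ^+ 2 = \sum_i normc (v i 0) ^+ 2.
Proof. by rewrite sqr_sqrtr // sum_sqr_ge0. Qed.

Lemma l2norm0 n : l2norm (0 : 'cV[R[i]]_n) = 0.
Proof.
rewrite /l2norm big1 ?sqrtr0 // => i _.
by rewrite mxE ComplexField.Normc.normc0 expr0n.
Qed.

Lemma l2norm_eq0 n (v : 'cV[R[i]]_n) : l2norm v = 0 -> v = 0.
Proof.
move=> v0; apply/colP => i; rewrite mxE; apply: ComplexField.Normc.eq0_normc.
apply/eqP; rewrite -sqrf_eq0; apply/eqP.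
have /psumr_eq0P H : forall i, true -> 0 <= normc (v i 0) ^+ 2.
  by move=> j _; exact: sqr_ge0.
by apply: H => //; rewrite -sqr_l2norm v0 expr0n.
Qed.

Lemma l2normZ n (c : R[i]) (v : 'cV[R[i]]_n) :
  l2norm (c *: v) = normc c * l2norm v.
Proof.
rewrite /l2norm (eq_bigr (fun i => normc c ^+ 2 * normc (v i 0) ^+ 2)).
  by rewrite -mulr_sumr sqrtrM ?sqr_ge0 // sqrtr_sqr ger0_norm // normc_ge0.
by move=> i _; rewrite mxE ComplexField.Normc.normcM exprMn.
Qed.

Lemma l2normD n (v w : 'cV[R[i]]_n) : l2norm (v + w) <= l2norm v + l2norm w.
Proof.
rewrite -(@ler_pXn2r _ 2) ?nnegrE ?addr_ge0 ?l2norm_ge0 //.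
rewrite sqrrD !sqr_l2norm.
apply: (@le_trans _ _ (\sum_i (normc (v i 0) + normc (w i 0)) ^+ 2)).
  apply: ler_sum => i _; rewrite mxE ler_pXn2r ?nnegrE ?addr_ge0 ?normc_ge0 //.
  exact: le_normcD.
rewrite (eq_bigr (fun i => normc (v i 0) ^+ 2 + normc (w i 0) ^+ 2 +
  2%:R * (normc (v i 0) * normc (w i 0)))); last by move=> i _; ring.
rewrite !big_split /= -mulr_sumr [leRHS]addrAC lerD2l.
rewrite -[leRHS]mulr_natl ler_pM2l ?ltr0n //.
exact: cauchy_schwarz_sum.
Qed.

Lemma l2norm_dot n (v w : 'cV[R[i]]_n) :
  normc ((v ^t* *m w) 0 0) <= l2norm v * l2norm w.
Proof.
rewrite mxE; apply: (le_trans (le_normc_sum _ _)).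
rewrite (eq_bigr (fun i => normc (v i 0) * normc (w i 0))).
  exact: cauchy_schwarz_sum.
by move=> i _; rewrite !mxE ComplexField.Normc.normcM normc_conj.
Qed.

Lemma l2norm_dotvv n (v : 'cV[R[i]]_n) :
  normc ((v ^t* *m v) 0 0) = l2norm v ^+ 2.
Proof.
rewrite sqr_l2norm mxE (eq_bigr (fun i => (normc (v i 0) ^+ 2)%:C%C)).
  by rewrite -rmorph_sum normc_real // sum_sqr_ge0.
by move=> i _; rewrite !mxE normcJM.
Qed.

Lemma l2norm_frobenius n (A : 'M[R[i]]_n) (v : 'cV[R[i]]_n) :
  l2norm (A *m v) <=
  Num.sqrt (\sum_i \sum_j normc (A i j) ^+ 2) * l2norm v.
Proof.
have F0 : 0 <= \sum_i \sum_j normc (A i j) ^+ 2.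
  by apply: sumr_ge0 => i _; exact: sum_sqr_ge0.
rewrite -(@ler_pXn2r _ 2) ?nnegrE ?mulr_ge0 ?sqrtr_ge0 ?l2norm_ge0 //.
rewrite exprMn !sqr_l2norm sqr_sqrtr // mulr_suml; apply: ler_sum => i _.
apply: (@le_trans _ _ ((\sum_j normc (A i j) * normc (v j 0)) ^+ 2)).
  rewrite ler_pXn2r ?nnegrE ?normc_ge0 ?sumr_ge0 //; last first.
    by move=> j _; rewrite mulr_ge0 ?normc_ge0.
  rewrite mxE; apply: (le_trans (le_normc_sum _ _)); apply: ler_sum => j _.
  by rewrite ComplexField.Normc.normcM.
rewrite -[X in _ <= X * _]sqr_sqrtr ?sum_sqr_ge0 //.
rewrite -[X in _ <= _ * X]sqr_sqrtr ?sum_sqr_ge0 //.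
rewrite -exprMn ler_pXn2r ?nnegrE ?mulr_ge0 ?sqrtr_ge0 //.
  exact: cauchy_schwarz_sum.
by apply: sumr_ge0 => j _; rewrite mulr_ge0 ?normc_ge0.
Qed.

Lemma opnorm_has_ubound n (A : 'M[R[i]]_n) :
  has_ubound [set l2norm (A *m v) | v in [set v : 'cV[R[i]]_n | l2norm v <= 1]].
Proof.
exists (Num.sqrt (\sum_i \sum_j normc (A i j) ^+ 2)) => _ [v /= v1 <-].
apply: (le_trans (l2norm_frobenius _ _)).
by rewrite ler_piMr // sqrtr_ge0.
Qed.

Lemma opnorm_ge0 n (A : 'M[R[i]]_n) : 0 <= opnorm A.
Proof.
apply: (ub_le_sup (opnorm_has_ubound A)); exists 0; first by rewrite /= l2norm0.
by rewrite mulmx0 l2norm0.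
Qed.

Lemma l2norm_opnorm n (A : 'M[R[i]]_n) (v : 'cV[R[i]]_n) :
  l2norm (A *m v) <= opnorm A * l2norm v.
Proof.
have [/l2norm_eq0 ->|v_neq0] := eqVneq (l2norm v) 0.
  by rewrite mulmx0 l2norm0 mulr0.
have v_gt0 : 0 < l2norm v by rewrite lt_def v_neq0 l2norm_ge0.
have nc : normc ((l2norm v)^-1)%:C%C = (l2norm v)^-1.
  by rewrite normc_real // invr_ge0 l2norm_ge0.
rewrite -ler_pdivrMr // mulrC -nc -l2normZ scalemxAr.
apply: (ub_le_sup (opnorm_has_ubound A)).
by exists (((l2norm v)^-1)%:C%C *: v); rewrite //= l2normZ nc mulVf.
Qed.

Lemma opnorm_le n (A : 'M[R[i]]_n) (M : R) : 0 <= M ->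
  (forall v : 'cV[R[i]]_n, l2norm (A *m v) <= M * l2norm v) -> opnorm A <= M.
Proof.
move=> M0 AM; apply: ge_sup.
  by exists (l2norm (A *m 0)), 0; rewrite //= l2norm0.
by move=> _ [v /= v1 <-]; apply: (le_trans (AM v)); rewrite ler_piMr.
Qed.

Lemma opnorm0 n : opnorm (0 : 'M[R[i]]_n) = 0.
Proof.
apply/le_anti; rewrite opnorm_ge0 andbT; apply: opnorm_le => // v.
by rewrite mul0mx l2norm0 mul0r.
Qed.

Lemma opnorm1_gt0 n : 0 < opnorm (1 : 'M[R[i]]_n.+1).
Proof.
rewrite lt_def opnorm_ge0 andbT; apply/eqP => o0.
have := l2norm_opnorm (1 : 'M[R[i]]_n.+1) (const_mx 1).
rewrite o0 mul0r mul1mx => l0.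
have /l2norm_eq0/colP/(_ 0) : l2norm (const_mx 1 : 'cV[R[i]]_n.+1) = 0.
  by apply/le_anti; rewrite l0 l2norm_ge0.
by rewrite !mxE => /eqP; rewrite oner_eq0.
Qed.

Lemma opnormD n (A B : 'M[R[i]]_n) : opnorm (A + B) <= opnorm A + opnorm B.
Proof.
apply: opnorm_le => [|v]; first by rewrite addr_ge0 ?opnorm_ge0.
rewrite mulmxDl mulrDl; apply: (le_trans (l2normD _ _)).
by apply: lerD; exact: l2norm_opnorm.
Qed.

Lemma opnormZ_le n (c : R[i]) (A : 'M[R[i]]_n) :
  opnorm (c *: A) <= normc c * opnorm A.
Proof.
apply: opnorm_le => [|v]; first by rewrite mulr_ge0 ?opnorm_ge0 ?normc_ge0.
rewrite -scalemxAl l2normZ -mulrA ler_wpM2l ?normc_ge0 //.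
exact: l2norm_opnorm.
Qed.

Lemma opnormN n (A : 'M[R[i]]_n) : opnorm (- A) = opnorm A.
Proof.
have H (B : 'M[R[i]]_n) : opnorm (- B) <= opnorm B.
  rewrite -scaleN1r; apply: (le_trans (opnormZ_le _ _)).
  by rewrite normcN ComplexField.Normc.normc1 mul1r.
by apply/le_anti/andP; split=> //; have := H (- A); rewrite opprK.
Qed.

Lemma opnormM n (A B : 'M[R[i]]_n) : opnorm (A *m B) <= opnorm A * opnorm B.
Proof.
apply: opnorm_le => [|v]; first by rewrite mulr_ge0 ?opnorm_ge0.
rewrite -mulmxA -mulrA; apply: (le_trans (l2norm_opnorm _ _)).
by rewrite ler_wpM2l ?opnorm_ge0 ?l2norm_opnorm.
Qed.

Lemma opnorm_star n (A : 'M[R[i]]_n) : opnorm (A ^t*) <= opnorm A.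
Proof.
apply: opnorm_le => [|v]; first exact: opnorm_ge0.
set w := A ^t* *m v.
have [->|w_neq0] := eqVneq (l2norm w) 0.
  by rewrite mulr_ge0 ?opnorm_ge0 ?l2norm_ge0.
have w_gt0 : 0 < l2norm w by rewrite lt_def w_neq0 l2norm_ge0.
rewrite -(ler_pM2r w_gt0) -expr2 -l2norm_dotvv.
rewrite {1}/w trmx_mul map_mxM trmxCK -mulmxA.
apply: (le_trans (l2norm_dot _ _)).
rewrite [leRHS]mulrAC [leRHS]mulrC ler_wpM2l ?l2norm_ge0 //.
exact: l2norm_opnorm.
Qed.

End OperatorNorm.

(* The l^oo-product of the matrix algebras of sizes [(m k).+1]; shifting the
   sizes keeps them positive. *)
Record mxprod (R : realType) (m : nat -> nat) := MxProd {
  mxprod_val :> forall k, 'M[R[i]]_((m k).+1);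
  mxprod_bounded : exists M : R, forall k, opnorm (mxprod_val k) <= M
}.

Section MxProd.
Variables (R : realType) (m : nat -> nat).
Local Notation T := (mxprod R m).
Implicit Types f g h : T.

HB.instance Definition _ := gen_eqMixin T.
HB.instance Definition _ := gen_choiceMixin T.

Lemma mxprodP f g : (forall k, f k = g k) -> f = g.
Proof.
case: f g => [f bf] [g bg] /= fg.
have {}fg : f = g by exact: functional_extensionality_dep.
by subst g; congr MxProd; exact: Prop_irrelevance.
Qed.

Lemma mxprod0_subproof :
  exists M : R, forall k, opnorm (0 : 'M[R[i]]_((m k).+1)) <= M.
Proof. by exists 0 => k; rewrite opnorm0. Qed.

Lemma mxprodN_subproof f : exists M : R, forall k, opnorm (- f k) <= M.
Proof.
by have [M fM] := mxprod_bounded f; exists M => k; rewrite opnormN.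
Qed.

Lemma mxprodD_subproof f g : exists M : R, forall k, opnorm (f k + g k) <= M.
Proof.
have [M fM] := mxprod_bounded f; have [N gN] := mxprod_bounded g.
by exists (M + N) => k; apply: (le_trans (opnormD _ _)); exact: lerD.
Qed.

Lemma mxprod1_subproof :
  exists M : R, forall k, opnorm (1 : 'M[R[i]]_((m k).+1)) <= M.
Proof.
by exists 1 => k; apply: opnorm_le => // v; rewrite mul1mx mul1r.
Qed.

Lemma mxprodM_subproof f g : exists M : R, forall k, opnorm (f k * g k) <= M.
Proof.
have [M fM] := mxprod_bounded f; have [N gN] := mxprod_bounded g.
exists (M * N) => k; apply: (le_trans (opnormM _ _)).
by rewrite ler_pM ?opnorm_ge0.
Qed.

Lemma mxprodZ_subproof (c : R[i]) f :
  exists M : R, forall k, opnorm (c *: f k) <= M.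
Proof.
have [M fM] := mxprod_bounded f; exists (normc c * M) => k.
by apply: (le_trans (opnormZ_le _ _)); rewrite ler_wpM2l ?normc_ge0.
Qed.

Lemma mxprod_star_subproof f :
  exists M : R, forall k, opnorm (star (f k)) <= M.
Proof.
have [M fM] := mxprod_bounded f; exists M => k.
exact: (le_trans (opnorm_star _)).
Qed.

Let zero : T := MxProd mxprod0_subproof.
Let opp f : T := MxProd (mxprodN_subproof f).
Let add f g : T := MxProd (mxprodD_subproof f g).
Let one : T := MxProd mxprod1_subproof.
Let mul f g : T := MxProd (mxprodM_subproof f g).
Let scale c f : T := MxProd (mxprodZ_subproof c f).
Let pstar f : T := MxProd (mxprod_star_subproof f).

Let addA : associative add.
Proof. by move=> f g h; apply: mxprodP => k /=; rewrite addrA. Qed.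
Let addC : commutative add.
Proof. by move=> f g; apply: mxprodP => k /=; rewrite addrC. Qed.
Let add0 : left_id zero add.
Proof. by move=> f; apply: mxprodP => k /=; rewrite add0r. Qed.
Let addN : left_inverse zero opp add.
Proof. by move=> f; apply: mxprodP => k /=; rewrite addNr. Qed.

HB.instance Definition _ := GRing.isZmodule.Build T addA addC add0 addN.

Let mulA : associative mul.
Proof. by move=> f g h; apply: mxprodP => k /=; rewrite mulrA. Qed.
Let mul1l : left_id one mul.
Proof. by move=> f; apply: mxprodP => k /=; rewrite mul1r. Qed.
Let mul1r' : right_id one mul.
Proof. by move=> f; apply: mxprodP => k /=; rewrite mulr1. Qed.
Let mulDl : left_distributive mul add.
Proof. by move=> f g h; apply: mxprodP => k /=; rewrite mulrDl. Qed.
Let mulDr : right_distributive mul add.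
Proof. by move=> f g h; apply: mxprodP => k /=; rewrite mulrDr. Qed.
Let one_neq0 : one != zero.
Proof.
apply/eqP => /(congr1 (fun f : T => f 0%N))/eqP /=.
by rewrite oner_eq0.
Qed.

HB.instance Definition _ :=
  GRing.Zmodule_isNzRing.Build T mulA mul1l mul1r' mulDl mulDr one_neq0.

Let scaleA (a b : R[i]) f : scale a (scale b f) = scale (a * b) f.
Proof. by apply: mxprodP => k /=; rewrite scalerA. Qed.
Let scale1 : left_id 1 scale.
Proof. by move=> f; apply: mxprodP => k /=; rewrite scale1r. Qed.
Let scaleDr : right_distributive scale +%R.
Proof. by move=> a f g; apply: mxprodP => k /=; rewrite scalerDr. Qed.
Let scaleDl f : {morph scale^~ f : a b / a + b}.
Proof. by move=> a b; apply: mxprodP => k /=; rewrite scalerDl. Qed.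

HB.instance Definition _ :=
  GRing.Zmodule_isLmodule.Build R[i] T scaleA scale1 scaleDr scaleDl.

Let scaleAl (c : R[i]) f g : c *: (f * g) = c *: f * g.
Proof. by apply: mxprodP => k /=; rewrite scalerAl. Qed.

HB.instance Definition _ := GRing.Lmodule_isLalgebra.Build R[i] T scaleAl.

Let scaleAr (c : R[i]) f g : c *: (f * g) = f * (c *: g).
Proof. by apply: mxprodP => k /=; rewrite scalerAr. Qed.

HB.instance Definition _ := GRing.Lalgebra_isAlgebra.Build R[i] T scaleAr.

Let pstarD : {morph pstar : f g / f + g}.
Proof. by move=> f g; apply: mxprodP => k /=; rewrite starD. Qed.
Let pstarZ (c : R[i]) f : pstar (c *: f) = c^* *: pstar f.
Proof. by apply: mxprodP => k /=; rewrite starZ. Qed.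
Let pstarM f g : pstar (f * g) = pstar g * pstar f.
Proof. by apply: mxprodP => k /=; rewrite starM. Qed.
Let pstarK : involutive pstar.
Proof. by move=> f; apply: mxprodP => k /=; rewrite starK. Qed.

HB.instance Definition _ := @isStarAlgebra.Build R T pstar
  pstarD pstarZ pstarM pstarK.

End MxProd.

Section Corona.
Variables (R : realType) (m : nat -> nat).
Local Notation T := (mxprod R m).
Implicit Types f g : T.

(* The c_0-sum of the same matrix algebras, as an ideal of [mxprod R m]. *)
Definition mxsum : pred T :=
  fun f => `[< opnorm (f k) @[k --> \oo] --> (0 : R) >].

Lemma mxsumP f : reflect (opnorm (f k) @[k --> \oo] --> (0 : R)) (f \in mxsum).
Proof. exact: asboolP. Qed.

Lemma mxsum_dominated f (u : nat -> R) :
  (forall k, opnorm (f k) <= u k) -> u @ \oo --> (0 : R) -> f \in mxsum.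
Proof.
move=> fu u0; apply/mxsumP; apply: (@squeeze_cvgr _ _ _ _ (cst 0) u) => //.
  by near=> k; rewrite fu opnorm_ge0.
exact: cvg_cst.
Unshelve. all: by end_near. Qed.

Lemma mxsum_zmod_closed : zmod_closed mxsum.
Proof.
split=> [|f g /mxsumP f0 /mxsumP g0].
  by apply: (@mxsum_dominated _ (cst 0)) => [k|]; [rewrite opnorm0|exact: cvg_cst].
apply: (@mxsum_dominated _ (fun k => opnorm (f k) + opnorm (g k))).
  by move=> k; apply: (le_trans (opnormD _ _)); rewrite opnormN.
by have h := cvgD f0 g0; rewrite addr0 in h; exact: h.
Qed.

HB.instance Definition _ := GRing.isZmodClosed.Build T mxsum mxsum_zmod_closed.

Lemma mxsumMl f g : g \in mxsum -> f * g \in mxsum.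
Proof.
move=> /mxsumP g0; have [M fM] := mxprod_bounded f.
apply: (@mxsum_dominated _ (fun k => M * opnorm (g k))).
  by move=> k; apply: (le_trans (opnormM _ _)); rewrite ler_wpM2r ?opnorm_ge0.
by rewrite -[0](mulr0 M); apply: cvgM => //; exact: cvg_cst.
Qed.

Lemma mxsumMr f g : f \in mxsum -> f * g \in mxsum.
Proof.
move=> /mxsumP f0; have [M gM] := mxprod_bounded g.
apply: (@mxsum_dominated _ (fun k => opnorm (f k) * M)).
  by move=> k; apply: (le_trans (opnormM _ _)); rewrite ler_wpM2l ?opnorm_ge0.
by rewrite -[0](mul0r M); apply: cvgM => //; exact: cvg_cst.
Qed.

Lemma mxsumZ (c : R[i]) f : f \in mxsum -> c *: f \in mxsum.
Proof. by move=> f0; rewrite -[f]mul1r scalerAl; exact: mxsumMl. Qed.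

Lemma mxsum_star f : f \in mxsum -> star f \in mxsum.
Proof.
move=> /mxsumP f0; apply: (mxsum_dominated _ f0) => k; exact: opnorm_star.
Qed.

Lemma mxsum1 : (1 : T) \notin mxsum.
Proof.
apply/negP => /mxsumP /cvgrPdist_lt/(_ 1 ltr01).
case=> k _ /(_ k (leqnn k)) /=; rewrite sub0r normrN ger0_norm ?opnorm_ge0 //.
rewrite ltNge => /negP; apply.
have := opnormM (1 : 'M[R[i]]_((m k).+1)) 1.
by rewrite mulmx1 -{1}[opnorm 1]mulr1 ler_pM2l ?opnorm1_gt0.
Qed.

Definition corona := @Quotient.quot T (GRing.ZmodClosed.clone T mxsum _).
Local Notation Q := corona.

HB.instance Definition _ := EqQuotient.on Q.
HB.instance Definition _ := GRing.Zmodule.on Q.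

Local Open Scope quotient_scope.

Lemma coronaE f g : (\pi_Q f = \pi_Q g) <-> (f - g \in mxsum).
Proof. by rewrite (rwP eqP) -Quotient.idealrBE. Qed.

Let piD f g : \pi_Q (f + g) = \pi_Q f + \pi_Q g.
Proof. by rewrite !piE. Qed.

Let one : Q := \pi_Q 1.
Let mul (a b : Q) : Q := \pi_Q (repr a * repr b).
Let scale (c : R[i]) (a : Q) : Q := \pi_Q (c *: repr a).
Let qstar (a : Q) : Q := \pi_Q (star (repr a)).

Let reprB f : repr (\pi_Q f) - f \in mxsum.
Proof. by apply/coronaE; rewrite reprK. Qed.

Let piM f g : \pi_Q (f * g) = mul (\pi_Q f) (\pi_Q g).
Proof.
apply/esym/coronaE; set f' := repr _; set g' := repr _.
rewrite -(subrKA (f' * g)) -mulrBr -mulrBl rpredD //.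
  by apply: mxsumMl; exact: reprB.
by apply: mxsumMr; exact: reprB.
Qed.

Let piZ c f : \pi_Q (c *: f) = scale c (\pi_Q f).
Proof. by apply/esym/coronaE; rewrite -scalerBr; apply/mxsumZ/reprB. Qed.

Let pi_star f : \pi_Q (star f) = qstar (\pi_Q f).
Proof.
apply/esym/coronaE; have -> : star (repr (\pi_Q f)) - star f =
    star (repr (\pi_Q f) - f).
  by rewrite starD -[- f]scaleN1r starZ rmorphN1 scaleN1r.
exact/mxsum_star/reprB.
Qed.

Let ind (P : Q -> Prop) : (forall f, P (\pi_Q f)) -> forall a, P a.
Proof. by move=> Pf a; rewrite -[a]reprK. Qed.

Let mulA : associative mul.
Proof.
elim/ind=> f; elim/ind=> g; elim/ind=> h.
by rewrite -!piM mulrA.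
Qed.
Let mul1l : left_id one mul.
Proof. by elim/ind=> f; rewrite -piM mul1r. Qed.
Let mul1r' : right_id one mul.
Proof. by elim/ind=> f; rewrite -piM mulr1. Qed.
Let mulDl : left_distributive mul +%R.
Proof.
elim/ind=> f; elim/ind=> g; elim/ind=> h.
by rewrite -piD -!piM -piD mulrDl.
Qed.
Let mulDr : right_distributive mul +%R.
Proof.
elim/ind=> f; elim/ind=> g; elim/ind=> h.
by rewrite -piD -!piM -piD mulrDr.
Qed.
Let one_neq0 : one != 0.
Proof.
have -> : 0 = \pi_Q 0 by rewrite piE.
by apply/eqP => /coronaE; rewrite subr0; apply/negP; exact: mxsum1.
Qed.

HB.instance Definition _ :=
  GRing.Zmodule_isNzRing.Build Q mulA mul1l mul1r' mulDl mulDr one_neq0.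

Let scaleA (a b : R[i]) (q : Q) : scale a (scale b q) = scale (a * b) q.
Proof. by elim/ind: q => f; rewrite -!piZ scalerA. Qed.
Let scale1 : left_id 1 scale.
Proof. by elim/ind=> f; rewrite -piZ scale1r. Qed.
Let scaleDr : right_distributive scale +%R.
Proof.
by move=> c; elim/ind=> f; elim/ind=> g; rewrite -piD -!piZ -piD scalerDr.
Qed.
Let scaleDl (q : Q) : {morph scale^~ q : a b / a + b}.
Proof. by elim/ind: q => f a b; rewrite -!piZ -piD scalerDl. Qed.

HB.instance Definition _ :=
  GRing.Zmodule_isLmodule.Build R[i] Q scaleA scale1 scaleDr scaleDl.

Let scaleAl (c : R[i]) (p q : Q) : c *: (p * q) = c *: p * q.
Proof.
elim/ind: p => f; elim/ind: q => g.
rewrite -[c *: _]/(scale c (mul _ _)) -[_ * _]/(mul (scale c _) _).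
by rewrite -piM -!piZ -piM scalerAl.
Qed.

HB.instance Definition _ := GRing.Lmodule_isLalgebra.Build R[i] Q scaleAl.

Let scaleAr (c : R[i]) (p q : Q) : c *: (p * q) = p * (c *: q).
Proof.
elim/ind: p => f; elim/ind: q => g.
rewrite -[c *: _]/(scale c (mul _ _)) -[_ * _]/(mul _ (scale c _)).
by rewrite -piM -!piZ -piM scalerAr.
Qed.

HB.instance Definition _ := GRing.Lalgebra_isAlgebra.Build R[i] Q scaleAr.

Let qstarD : {morph qstar : p q / p + q}.
Proof.
by elim/ind=> f; elim/ind=> g; rewrite -piD -!pi_star -piD starD.
Qed.
Let qstarZ (c : R[i]) (q : Q) : qstar (c *: q) = c^* *: qstar q.
Proof.
elim/ind: q => f; rewrite -[c *: _]/(scale c _) -[_ *: qstar _]/(scale _ _).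
by rewrite -piZ -!pi_star -piZ starZ.
Qed.
Let qstarM (p q : Q) : qstar (p * q) = qstar q * qstar p.
Proof.
elim/ind: p => f; elim/ind: q => g.
rewrite -[_ * \pi_Q g]/(mul _ _) -[_ * qstar _]/(mul _ _).
by rewrite -piM -!pi_star -piM starM.
Qed.
Let qstarK : involutive qstar.
Proof. by elim/ind=> f; rewrite -!pi_star starK. Qed.

HB.instance Definition _ := @isStarAlgebra.Build R Q qstar
  qstarD qstarZ qstarM qstarK.

End Corona.

(* An embedding is an injective *-homomorphism, not required to be unital
   (injective *-homomorphisms between C*-algebras are isometric). *)
Definition MF_algebra (R : realType) (A : cstarAlgType R) : Prop :=
  exists m : nat -> nat, {homo m : i j / (i < j)%N} /\
  exists phi : {linear A -> corona R m},
    [/\ injective phi, {morph phi : a b / a * b} &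
        forall a, phi (star a) = star (phi a)].

Definition tracial_state (R : realType) (A : cstarAlgType R)
    (tau : {scalar A}) : Prop :=
  [/\ forall a : A, 0 <= tau (star a * a), tau 1 = 1 &
      forall a b : A, tau (a * b) = tau (b * a)].

Definition ntr (R : realType) k (A : 'M[R[i]]_k.+1) : R[i] :=
  \tr A / k.+1%:R.

(* MF-traces of the algebra generated by [z]; the k-th matrices have size
   [(m k).+1], and no monotonicity of [m] is required. *)
Definition MF_traces (R : realType) (A : cstarAlgType R) (N : nat)
    (z : 'I_N -> A) : set {scalar A} :=
  [set tau | tracial_state tau /\
    exists (m : nat -> nat) (B : forall k, 'I_N -> 'M[R[i]]_((m k).+1)),
    forall Q : starpoly R 'I_N,
      opnorm (stareval (B k) Q) @[k --> \oo] --> cnorm (stareval z Q) /\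
      normc (ntr (stareval (B k) Q) - tau (stareval z Q)) @[k --> \oo] -->
        (0 : R)].

Definition fcat (T : Type) n m (x : 'I_n -> T) (y : 'I_m -> T)
    (i : 'I_(n + m)) : T :=
  match fintype.split i with inl j => x j | inr j => y j end.

Section OrbitDimension.
Variable R : realType.

Definition norm2 n k (A : 'I_n -> 'M[R[i]]_k.+1) : R :=
  Num.sqrt (complex.Re (\sum_i ntr (star (A i) * A i))).

Definition orbit_ball n k (w : R) (B : 'I_n -> 'M[R[i]]_k.+1) :
    set ('I_n -> 'M[R[i]]_k.+1) :=
  [set A | exists2 W : 'M[R[i]]_k.+1, W \is unitarymx &
    norm2 (fun i => A i - W * B i * star W) < w].

(* It is [+oo] when no finite covering exists. *)
Definition o2 n k (S : set ('I_n -> 'M[R[i]]_k.+1)) (w : R) : \bar R :=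
  ereal_inf [set N%:R%:E | N in [set N : nat |
    exists B : 'I_N -> 'I_n -> 'M[R[i]]_k.+1,
      (forall j, S (B j)) /\ S `<=` \bigcup_j orbit_ball w (B j)]].

(* [S k] is a set of tuples of matrices of size [k.+1], whence the
   normalization; [lne 0 = -oo]. *)
Definition orbit_growth n (S : forall k, set ('I_n -> 'M[R[i]]_k.+1))
    (w : R) : \bar R :=
  limn_esup (fun k => lne (o2 (S k) w) * ((k.+1%:R ^+ 2)^-1)%:E)%E.

Variables (A : cstarAlgType R) (n m : nat).
Variables (x : 'I_n -> A) (y : 'I_m -> A).

(* The first [r] polynomials are [P 0, ..., P r.-1]. *)
Definition Gamma_top (P : nat -> ncpoly R 'I_(n + m)) (r0 : R) (eps : R)
    (r : nat) (k : nat) : set ('I_n -> 'M[R[i]]_k.+1) :=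
  [set X | exists Y : 'I_m -> 'M[R[i]]_k.+1,
    (forall i, selfadjoint (fcat X Y i) /\ opnorm (fcat X Y i) <= r0) /\
    forall j, (j < r)%N ->
      `| opnorm (nceval (fcat X Y) (P j)) - cnorm (nceval (fcat x y) (P j)) |
      <= eps].

Definition K_top (P : nat -> ncpoly R 'I_(n + m)) : \bar R :=
  ereal_sup [set ereal_sup [set ereal_inf
    [set orbit_growth (Gamma_top P r0 er.1 er.2) w
      | er in [set er : R * nat | 0 < er.1]]
    | r0 in [set r0 : R | 0 < r0]]
  | w in [set w : R | 0 < w]].

Definition Gamma (tau : A -> R[i]) (r0 : R) (p : nat) (eps : R) (k : nat) :
    set ('I_n -> 'M[R[i]]_k.+1) :=
  [set X | exists Y : 'I_m -> 'M[R[i]]_k.+1,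
    (forall i, selfadjoint (fcat X Y i) /\ opnorm (fcat X Y i) <= r0) /\
    forall w : seq 'I_(n + m), (1 <= size w <= p)%N ->
      normc (ntr (\prod_(i <- w) fcat X Y i) -
             tau (\prod_(i <- w) fcat x y i)) < eps].

Definition K2 (tau : A -> R[i]) : \bar R :=
  limf_esup (fun w : R => ereal_sup [set ereal_inf
    [set orbit_growth (Gamma tau r0 pe.1 pe.2) w
      | pe in [set pe : nat * R | 0 < pe.2]]
    | r0 in [set r0 : R | 0 < r0]]) (0^'+).

End OrbitDimension.

(* Main.v *)
Require Import Defs.
From HB Require Import structures.
From mathcomp Require Import all_boot all_order all_algebra.
From mathcomp Require Import all_classical all_reals all_analysis.
From mathcomp Require Import complex.
From mathcomp Require Import -(notations) finmap monalg.
From mathcomp Require Import ring lra.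

Set Implicit Arguments.
Unset Strict Implicit.
Unset Printing Implicit Defensive.

Import Order.TTheory GRing.Theory Num.Theory.
Import numFieldNormedType.Exports.
Local Open Scope classical_set_scope.
Local Open Scope ring_scope.
Local Open Scope sesquilinear_scope.

(** Fix a radius [w], a norm bound [r0] and a real number [alpha] which is at
    most the growth rate of all the sets [Gamma_top] at these parameters.  It
    suffices to find one MF-trace [tau] with [alpha <= K2 tau].

    Call a family of tuples of matrices of all sizes slow if its orbit covering
    numbers grow at a rate strictly below [alpha].  Slow families form an ideal:
    doubling a covering number is invisible after taking logarithms and dividing
    by [k ^ 2] ([slowU]).  The families of tuples on which finitely many
    polynomials have almost the same norms as on the generators [z] generate a
    filter, and none of them is slow by the choice of [alpha].  So there is an
    ultrafilter [U] that contains all of them and no slow family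
    ([ultrafilter_avoiding]).

    Along [U] the norm of [Q] at a tuple of matrices tends to the norm of
    [Q(z)], first for the rational polynomials and then for all of them
    ([norm_lim_all]).  Since a normalized trace is bounded by the operator norm,
    the normalized traces of the matrices [Q(t)] converge along [U] to a value
    that depends only on [Q(z)] and is contractive in it; by density this
    defines a functional [tau] on the whole algebra ([limit_trace_ex]), which is
    a tracial state ([limit_trace_tracial]).  There are only countably many
    rational polynomials, so a sequence of tuples picked from suitable members
    of [U] exhibits [tau] as an MF-trace ([limit_trace_MF]).

    Finally each set of microstates of [tau] comes from a member of [U].  It is
    therefore not slow, so its covering numbers grow at least at the rate
    [alpha], for every small radius ([K2_ge_of_models]). *)

(** * Normalized traces and covering numbers of unitary orbits *)

Section Covering.
Variable R : realType.

Lemma starN (A : starAlgType R) (a : A) : star (- a) = - star a.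
Proof. by rewrite -scaleN1r starZ rmorphN1 scaleN1r. Qed.

Lemma fcatl T n m (x : 'I_n -> T) (y : 'I_m -> T) j :
  fcat x y (lshift m j) = x j.
Proof. by rewrite /fcat (unsplitK (inl j)). Qed.

Lemma fcatr T n m (x : 'I_n -> T) (y : 'I_m -> T) j :
  fcat x y (rshift n j) = y j.
Proof. by rewrite /fcat (unsplitK (inr j)). Qed.

Section Norm2.
Variables n k : nat.
Implicit Types X Y : 'I_n -> 'M[R[i]]_k.+1.

Definition sqr_norm2 X : R := complex.Re (\sum_i ntr (star (X i) * X i)).

Lemma ntrD (A B : 'M[R[i]]_k.+1) : ntr (A + B) = ntr A + ntr B.
Proof. by rewrite /ntr raddfD mulrDl. Qed.

Lemma ntrZ (c : R[i]) (A : 'M[R[i]]_k.+1) : ntr (c *: A) = c * ntr A.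
Proof. by rewrite /ntr linearZ /= mulrA. Qed.

Lemma ntrB (A B : 'M[R[i]]_k.+1) : ntr (A - B) = ntr A - ntr B.
Proof. by rewrite ntrD -scaleN1r ntrZ mulN1r. Qed.

Lemma ntrC (A B : 'M[R[i]]_k.+1) : ntr (A * B) = ntr (B * A).
Proof. by rewrite /ntr mxtrace_mulC. Qed.

Lemma ntr1 : ntr (1 : 'M[R[i]]_k.+1) = 1.
Proof. by rewrite /ntr mxtrace1 divff // pnatr_eq0. Qed.

Lemma ntr_star_ge0 (A : 'M[R[i]]_k.+1) : 0 <= ntr (star A * A).
Proof.
rewrite divr_ge0 ?ler0n //; apply: sumr_ge0 => i _.
rewrite mxE; apply: sumr_ge0 => j _; rewrite !mxE /=.
by rewrite normcJM lecR sqr_ge0.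
Qed.

Lemma sqr_norm2_ge0 X : 0 <= sqr_norm2 X.
Proof.
have : 0 <= \sum_i ntr (star (X i) * X i).
  by apply: sumr_ge0 => i _; exact: ntr_star_ge0.
by rewrite lecE /= => /andP[].
Qed.

Lemma sqr_norm2_parallelogram X Y :
  sqr_norm2 (fun i => X i + Y i) + sqr_norm2 (fun i => X i - Y i) =
  2 * sqr_norm2 X + 2 * sqr_norm2 Y.
Proof.
rewrite /sqr_norm2 -raddfD /= -big_split /= !mulr_natl !mulr2n -!raddfD /=.
rewrite -!big_split /=; congr (complex.Re _); apply: eq_bigr => i _.
rewrite -!ntrD; congr (ntr _).
rewrite !starD starN !mulrDl !mulrDr !mulNr !mulrN.
rewrite opprK.
set a := star _ * _; set b := _ * _; set c := _ * _; set d := star _ * _.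
rewrite addrACA [a + b + _]addrACA subrr addr0 [c + d + _]addrACA.
by rewrite addrN add0r.
Qed.

Lemma sqr_norm2_add_le X Y :
  sqr_norm2 (fun i => X i + Y i) <= 2 * sqr_norm2 X + 2 * sqr_norm2 Y.
Proof. by rewrite -sqr_norm2_parallelogram lerDl sqr_norm2_ge0. Qed.

Lemma sqr_norm2_conj (W : 'M[R[i]]_k.+1) X :
  star W * W = 1 -> sqr_norm2 (fun i => W * X i * star W) = sqr_norm2 X.
Proof.
move=> W1; congr (complex.Re _); apply: eq_bigr => i _.
rewrite !starM starK !mulrA ntrC !mulrA W1 mul1r.
by rewrite -[_ * star W * W]mulrA W1 mulr1.
Qed.

Lemma norm2_lt X (w : R) : 0 < w -> (norm2 X < w) = (sqr_norm2 X < w ^+ 2).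
Proof.
by move=> w0; rewrite -[in LHS](gtr0_norm w0) -sqrtr_sqr ltr_sqrt ?exprn_gt0.
Qed.

Lemma unitary_starK (W : 'M[R[i]]_k.+1) : W \is unitarymx ->
  W * star W = 1 /\ star W * W = 1.
Proof. by move=> Wu; split; [apply/unitarymxP|apply/mulmx1C/unitarymxP]. Qed.

Lemma half_sqrD (a b w : R) :
  a < (w / 2) ^+ 2 -> b < (w / 2) ^+ 2 -> 2 * a + 2 * b < w ^+ 2.
Proof.
have -> : (w / 2) ^+ 2 = w ^+ 2 / 4 by field.
by lra.
Qed.

(** If [X] is near [W Z W^*] and [Y] is near [V Z V^*], then [X] is near the
    conjugate of [Y] by [W V^*].  This trades a covering by arbitrary centers
    for a covering by centers in the set, at the cost of doubling the radius.
    The parallelogram law replaces the triangle inequality: two vectors of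
    norm below [w / 2] add up to a vector of norm below [w]. *)
Lemma orbit_ball_half (w : R) X Y Z : 0 < w ->
  orbit_ball (w / 2) Z X -> orbit_ball (w / 2) Z Y -> orbit_ball w Y X.
Proof.
move=> w0 [W Wu XW] [V Vu YV]; have w20 : 0 < w / 2 by rewrite divr_gt0.
have [WW' W'W] := unitary_starK Wu; have [VV' V'V] := unitary_starK Vu.
exists (W * star V).
  apply/unitarymxP; change (W * star V * star (W * star V) = 1).
  by rewrite starM starK mulrA -[_ * V]mulrA V'V mulr1.
rewrite norm2_lt //.
rewrite /mkset (norm2_lt _ w20) in XW.
rewrite /mkset (norm2_lt _ w20) in YV.
have -> : (fun i => X i - W * star V * Y i * star (W * star V)) =
    (fun i => (X i - W * Z i * star W) +
       - (W * star V) * (Y i - V * Z i * star V) * star (W * star V)).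
  apply/funext => i; rewrite !mulNr mulrBr mulrBl starM starK.
  have -> : W * star V * (V * Z i * star V) * (V * star W) = W * Z i * star W.
    rewrite [LHS](_ : _ = W * (star V * V) * Z i * (star V * V) * star W).
      by rewrite V'V !mulr1.
    by rewrite !mulrA.
  by rewrite opprB addrA subrK.
apply: le_lt_trans (sqr_norm2_add_le _ _) _.
(* The sign makes both occurrences of the unitary the same [U], up to the
   opposite of the difference that is conjugated. *)
set U := - (W * star V).
have U1 : star U * U = 1.
  by rewrite starN mulrNN starM starK mulrA -[V * _ * W]mulrA W'W mulr1.
have -> : (fun i => U * (Y i - V * Z i * star V) * star (W * star V)) =
    (fun i => U * - (Y i - V * Z i * star V) * star U).
  apply/funext => i; rewrite [star U]starN.
  by rewrite [in RHS]mulrN [in RHS]mulrN [in RHS]mulNr opprK.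
rewrite sqr_norm2_conj //.
have -> : sqr_norm2 (fun i => - (Y i - V * Z i * star V)) =
          sqr_norm2 (fun i => Y i - V * Z i * star V).
  congr (complex.Re _); apply: eq_bigr => i _.
  by rewrite starN mulrNN.
by apply: half_sqrD; [exact: XW|exact: YV].
Qed.

Lemma orbit_ball_le (w w' : R) X :
  w <= w' -> orbit_ball w X `<=` orbit_ball w' X.
Proof. by move=> ww' Y [W Wu YW]; exists W => //; exact: lt_le_trans ww'. Qed.

Implicit Types S : set ('I_n -> 'M[R[i]]_k.+1).

Definition coverable S (w : R) (N : nat) : Prop :=
  exists B : 'I_N -> 'I_n -> 'M[R[i]]_k.+1,
    S `<=` \bigcup_j orbit_ball w (B j).

Lemma coverableS S S' w w' N : S `<=` S' -> w' <= w ->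
  coverable S' w' N -> coverable S w N.
Proof.
move=> SS' ww' [B S'B]; exists B => X /SS' /S'B[j _ XB].
by exists j; [exact: I|exact: orbit_ball_le XB].
Qed.

Lemma coverableU S S' w N N' : coverable S w N -> coverable S' w N' ->
  coverable (S `|` S') w (N + N').
Proof.
move=> [B SB] [B' SB']; exists (fcat B B') => X [/SB|/SB'] [j _ Xj].
  by exists (lshift N' j); [exact: I|rewrite fcatl; exact: Xj].
by exists (rshift N j); [exact: I|rewrite fcatr; exact: Xj].
Qed.

(** Each center is replaced by a point of [S] in its ball, if there is one;
    balls that miss [S] get an arbitrary point of [S]. *)
Lemma coverable_o2 S w N : 0 < w -> coverable S (w / 2) N ->
  (o2 S w <= N%:R%:E)%E.
Proof.
move=> w0 [B SB]; have [[X0 SX0]|S0] := pselect (S !=set0); last first.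
  apply: (@le_trans _ _ 0%:R%:E); last by rewrite lee_fin ler_nat.
  apply: ereal_inf_lbound; exists 0%N => //.
  by exists (fun _ _ => 0); split=> [[]//|X SX]; case: S0; exists X.
have /choice[C CB] : forall j, exists C, S C /\
    (forall X, S X -> orbit_ball (w / 2) (B j) X -> orbit_ball w C X).
  move=> j; have [[C [SC BC]]|noC] :=
    pselect (exists C, S C /\ orbit_ball (w / 2) (B j) C).
    by exists C; split=> // X _ BX; exact: orbit_ball_half BX BC.
  by exists X0; split=> // X SX BX; case: noC; exists X.
apply: ereal_inf_lbound; exists N => //; exists C; split=> [j|X SX].
  by have [] := CB j.
by have [j _ BX] := SB X SX; exists j; [exact: I|have [_] := CB j; apply].
Qed.

Lemma o2_coverable S w (c : R) : (o2 S w < c%:E)%E ->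
  exists2 N, coverable S w N & N%:R < c.
Proof.
move=> /ereal_inf_lt[_ [N [B [_ SB]] <-]]; rewrite lte_fin => Nc.
by exists N => //; exists B.
Qed.

End Norm2.

Section Slow.
Variables (n : nat) (w alpha : R).
Implicit Types S : forall k, set ('I_n -> 'M[R[i]]_k.+1).

(** The sets whose orbit covering numbers grow at a rate strictly below
    [alpha].  Centers are arbitrary here because [o2] is not monotone: a subset
    may contain none of the centers that are efficient for the whole set. *)
Definition slow S : Prop := exists2 beta : R, beta < alpha &
  \forall k \near \oo, exists2 N,
    coverable (S k) w N & N%:R <= expR (beta * k.+1%:R ^+ 2).

Lemma slow0 S : (forall k, S k = set0) -> slow S.
Proof.
move=> S0; exists (alpha - 1); first by rewrite ltrBlDr ltrDl.
apply: nearW => k; exists 0%N; last exact: expR_ge0.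
by exists (fun _ _ => 0); rewrite S0.
Qed.

Lemma slowS S S' : (forall k, S k `<=` S' k) -> slow S' -> slow S.
Proof.
move=> SS' [b ba Sb]; exists b => //; near=> k.
have [//|N NS NE] := near Sb k.
by exists N => //; exact: coverableS NS.
Unshelve. all: by end_near. Qed.

(** Doubling a covering number is invisible at the scale [k ^ 2]. *)
Lemma slowU S S' : slow S -> slow S' -> slow (fun k => S k `|` S' k).
Proof.
move=> [b ba Sb] [b' b'a Sb'].
set g := Num.max b b'; set d := (alpha - g) / 2.
have ga : g < alpha by rewrite gt_max ba b'a.
have d0 : 0 < d by rewrite divr_gt0 // subr_gt0.
exists (g + d); first by rewrite /d; lra.
near=> k.
have [//|N NS Nb] := near Sb k.
have [//|N' NS' Nb'] := near Sb' k.
exists (N + N')%N; first exact: coverableU.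
set K : R := k.+1%:R ^+ 2 in Nb Nb' *.
have K0 : 0 <= K by rewrite sqr_ge0.
have le_g c : c <= g -> expR (c * K) <= expR (g * K).
  by move=> cg; rewrite ler_expR ler_wpM2r.
apply: (@le_trans _ _ (2 * expR (g * K))).
  rewrite natrD mulr_natl mulr2n; apply: lerD.
    by apply: (le_trans Nb); apply: le_g; rewrite le_max lexx.
  by apply: (le_trans Nb'); apply: le_g; rewrite le_max lexx orbT.
rewrite [(g + d) * _]mulrDl expRD mulrC ler_pM2l ?expR_gt0 //.
have : 1 + d * K <= expR (d * K) by exact: expR_ge1Dx.
apply: le_trans; rewrite -[2]/(1 + 1) lerD2l.
rewrite mulrC -ler_pdivrMr // div1r.
have dk : d^-1 <= k%:R by near: k; exact: nbhs_infty_ger.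
apply: (le_trans dk); apply: (@le_trans _ _ k.+1%:R); first by rewrite ler_nat.
by rewrite /K expr2 ler_peMr ?ler0n // ler1n.
Unshelve. all: by end_near. Qed.

(** The room between the growth rate and [alpha] is used twice: a real [b] is
    put above the growth rate, even when that is minus infinity, and then [c]
    above [b], so that the infimum defining [o2] is nearly attained by an
    actual number of balls. *)
Lemma growth_slow S : (orbit_growth S w < alpha%:E)%E -> slow S.
Proof.
move=> /ereal_inf_lt[_ [V FV <-]] supV.
have [b /andP[supb ba]] : exists b : R,
    (ereal_sup [set (lne (o2 (S k) w) * (k.+1%:R ^+ 2)^-1%:E)%E | k in V]
      <= b%:E)%E && (b < alpha).
  case: (ereal_sup _) supV => [r| |].
  - by rewrite lte_fin => ra; exists r; rewrite lexx.
  - by rewrite ltNge leey.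
  - by move=> _; exists (alpha - 1); rewrite leNye /= ltrBlDr ltrDl ltr01.
have [c /andP[bc ca]] : exists c, b < c < alpha.
  by exists ((b + alpha) / 2); apply/andP; split; lra.
exists c => //; near=> k.
have Vk : V k by near: k.
set K : R := k.+1%:R ^+ 2; have K0 : 0 < K by rewrite exprn_gt0 ?ltr0n.
have o2b : (lne (o2 (S k) w) <= (b * K)%:E)%E.
  rewrite EFinM -lee_pdivrMr //; apply: le_trans supb.
  by apply: ereal_sup_ubound; exists k.
have [//|N SN Nc] := @o2_coverable n k (S k) w (expR (c * K)) _.
  have : (lne (o2 (S k) w) < (c * K)%:E)%E.
    by apply: le_lt_trans o2b _; rewrite lte_fin ltr_pM2r.
  case: (o2 (S k) w) => [r| |] /=; last 2 first.
  - by rewrite ltNge leey.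
  - by rewrite !ltNyr.
  case: ifPn => [r0 _|]; first by rewrite lte_fin (le_lt_trans r0) ?expR_gt0.
  rewrite -ltNge => r0; rewrite !lte_fin => rc.
  by rewrite -[r]lnK ?posrE // ltr_expR.
by exists N => //; exact: ltW.
Unshelve. all: by end_near. Qed.

End Slow.

(** The converse of [growth_slow] costs a factor 2 in the radius, because [o2]
    only allows centers in the set. *)
Lemma slow_growth n (w alpha : R) (S : forall k, set ('I_n -> 'M[R[i]]_k.+1)) :
  0 < w -> slow (w / 2) alpha S -> (orbit_growth S w < alpha%:E)%E.
Proof.
move=> w0 [b ba Sb]; apply: (@le_lt_trans _ _ b%:E); last by rewrite lte_fin.
apply: ge_ereal_inf; eexists; first by eexists; [exact: Sb|reflexivity].
apply: ge_ereal_sup => _ [k /= [N SN Nb] <-].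
have K0 : 0 < (k.+1%:R ^+ 2 : R) by rewrite exprn_gt0 ?ltr0n.
rewrite lee_pdivrMr // -EFinM.
have := coverable_o2 w0 SN; case: (o2 _ _) => [r| |] /=; last 2 first.
- by rewrite leNgt ltry.
- by rewrite !leNye.
rewrite lee_fin => rN; case: ifPn => [_|]; first by rewrite leNye.
rewrite -ltNge => r0; rewrite lee_fin -[leRHS]expRK ler_ln ?posrE ?expR_gt0 //.
exact: le_trans rN Nb.
Qed.

End Covering.

(** * Noncommutative polynomials *)

Section Polynomials.
Variables (R : realType) (I : choiceType).
Implicit Types (P Q : ncpoly R I) (w : fmonom I).

Definition word (c : R[i]) (s : seq I) : ncpoly R I := mkmalgU (FMonom s) c.

Section Eval.
Variables (A : algType R[i]) (z : I -> A).

Lemma ncevalE Q :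
  nceval z Q = \sum_(w <- msupp Q) mcoeff w Q *: \prod_(i <- w) z i.
Proof. by rewrite /nceval mmapE; apply: eq_bigr => w _; rewrite mulr_algl. Qed.

Lemma nceval_word c s : nceval z (word c s) = c *: \prod_(i <- s) z i.
Proof. by rewrite /nceval /word mmapU mulr_algl. Qed.

Lemma ncevalD P Q : nceval z (P + Q) = nceval z P + nceval z Q.
Proof. by rewrite /nceval raddfD. Qed.

Lemma ncevalB P Q : nceval z (P - Q) = nceval z P - nceval z Q.
Proof. by rewrite /nceval raddfB. Qed.

Lemma nceval_sum (J : Type) (r : seq J) (F : J -> ncpoly R I) :
  nceval z (\sum_(j <- r) F j) = \sum_(j <- r) nceval z (F j).
Proof. by rewrite /nceval raddf_sum. Qed.

Lemma nceval1 : nceval z (1 : ncpoly R I) = 1.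
Proof.
have -> : (1 : ncpoly R I) = word 1 [::].
  by rewrite /word -fmoneE.
by rewrite nceval_word big_nil scale1r.
Qed.

Lemma ncevalM P Q : nceval z (P * Q) = nceval z P * nceval z Q.
Proof.
rewrite malgME !nceval_sum [in RHS](ncevalE P) mulr_suml.
apply: eq_bigr => v _; rewrite nceval_sum (ncevalE Q) mulr_sumr.
apply: eq_bigr => w _.
have -> : mmul v w = FMonom (v ++ w) by rewrite -fmmulE.
rewrite -[mkmalgU _ _]/(word _ _) nceval_word big_cat /=.
by rewrite -scalerAl -scalerAr scalerA.
Qed.

Lemma ncevalZ (c : R[i]) Q : nceval z (c *: Q) = c *: nceval z Q.
Proof.
rewrite -mul_malgC ncevalM.
have -> : malgC c = word c [::] :> ncpoly R I by rewrite /word -fmoneE.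
by rewrite nceval_word big_nil -scalerAl mul1r.
Qed.

End Eval.

Section StarEval.
Variables (A : starAlgType R) (z : I -> A).
Hypothesis z_sa : forall i, selfadjoint (z i).

Lemma star0 : star (0 : A) = 0.
Proof. by rewrite -(scale0r (0 : A)) starZ rmorph0 !scale0r. Qed.

Lemma starB (a b : A) : star (a - b) = star a - star b.
Proof. by rewrite starD starN. Qed.

Lemma star1 : star (1 : A) = 1.
Proof. by rewrite -[LHS]mulr1 -[X in _ * X]starK -starM mulr1 starK. Qed.

Definition ncstar Q : ncpoly R I :=
  \sum_(w <- msupp Q) word (mcoeff w Q)^* (rev w).

Lemma nceval_star Q : nceval z (ncstar Q) = star (nceval z Q).
Proof.
rewrite nceval_sum ncevalE (big_morph _ (@starD _ A) star0).
apply: eq_bigr => w _; rewrite nceval_word starZ; congr (_ *: _).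
elim: (w : seq I) => [|i s IHs]; first by rewrite !big_nil star1.
by rewrite rev_cons -cats1 big_cat /= big_seq1 big_cons starM IHs z_sa.
Qed.

End StarEval.

Definition rational_ncpoly Q := forall w, gaussian_rational (mcoeff w Q).

Lemma gaussian_rational_dense (c : R[i]) (e : R) : 0 < e ->
  exists2 c', gaussian_rational c' & normc (c - c') < e.
Proof.
case: c => a b e0; have e20 : 0 < e / 2 by rewrite divr_gt0.
have approx (x : R) : exists q : rat, `|x - ratr q| < e / 2.
  have [|q] := @rat_in_itvoo R (x - e / 2) (x + e / 2); first by lra.
  by rewrite in_itv /= => xq; exists q; rewrite distrC ltr_distl.
have [p ap] := approx a; have [q bq] := approx b.
exists (Complex (ratr p) (ratr q)); first by exists p, q.
have -> : Complex a b - Complex (ratr p) (ratr q) =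
   (a - ratr p)%:C%C + 'i * (b - ratr q)%:C%C.
  by simpc.
apply: le_lt_trans (le_normcD _ _) _.
rewrite ComplexField.Normc.normcM /= !expr0n /= !addr0 add0r expr1n sqrtr1 mul1r.
by rewrite !sqrtr_sqr; lra.
Qed.

Lemma gaussian_rationalD (c d : R[i]) :
  gaussian_rational c -> gaussian_rational d -> gaussian_rational (c + d).
Proof.
move=> [a [b ->]] [a' [b' ->]]; exists (a + a'), (b + b').
by rewrite !rmorphD.
Qed.

Lemma gaussian_rational0 : gaussian_rational (0 : R[i]).
Proof. by exists 0, 0; rewrite rmorph0. Qed.

(** Replacing each coefficient of [Q] by a close Gaussian rational changes the
    value of [Q] by little, uniformly over all tuples, in all seminormed
    algebras, whose words have norms below a prescribed function [C]. *)
Lemma rational_approx Q (C : fmonom I -> R) (e : R) : 0 < e ->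
  exists2 Q', rational_ncpoly Q' &
    forall (A : algType R[i]) (N : A -> R) (z : I -> A),
      (forall a b, N (a + b) <= N a + N b) ->
      (forall c a, N (c *: a) <= normc c * N a) ->
      (forall w, 0 <= N (\prod_(i <- w) z i) <= C w) ->
      N (nceval z Q - nceval z Q') < e.
Proof.
move=> e0.
(* Each of the [size (msupp Q)] terms gets an error of at most [e / s], which
   leaves a strict inequality for the sum, even when [Q = 0]. *)
set s : R := (size (msupp Q)).+1%:R.
have s0 : 0 < s by rewrite ltr0n.
pose D w := `|C w| + 1; have D0 w : 0 < D w by rewrite ltr_wpDl.
have /choice[c cP] : forall w, exists c, gaussian_rational c /\
    normc (mcoeff w Q - c) < e / (s * D w).
  move=> w; have [c] := gaussian_rational_dense (mcoeff w Q)
    (divr_gt0 e0 (mulr_gt0 s0 (D0 w))).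
  by exists c.
exists (\sum_(w <- msupp Q) mkmalgU w (c w)).
  move=> v; rewrite raddf_sum /=; apply: big_ind => [||w _].
  - exact: gaussian_rational0.
  - exact: gaussian_rationalD.
  rewrite mcoeffU; case: eqP => _; first by rewrite mulr1n; have [] := cP w.
  by rewrite mulr0n; exact: gaussian_rational0.
move=> A N z ND NZ NC; rewrite nceval_sum ncevalE -sumrB.
apply: (@le_lt_trans _ _ (\sum_(w <- msupp Q) e / s)); last first.
  rewrite big_const_seq count_predT iter_addr addr0 -mulr_natr mulrAC.
  by rewrite ltr_pdivrMr // ltr_pM2l // ltr_nat.
have N0 : N 0 <= 0.
  have := NZ 0 0; rewrite scale0r; move=> /le_trans; apply.
  by rewrite ComplexField.Normc.normc0 mul0r.
apply: (big_rec2 (fun a y => N a <= y)) => // w a y _ ya.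
apply: (le_trans (ND _ _)); apply: lerD => //.
have -> : mkmalgU w (c w) = word (c w) w by rewrite /word fmK.
rewrite nceval_word -scalerBl; apply: (le_trans (NZ _ _)).
have [_ /ltW cw] := cP w; have /andP[N0w NCw] := NC w.
apply: (@le_trans _ _ (e / (s * D w) * D w)).
  apply: ler_pM => //; first exact: normc_ge0.
  by rewrite (le_trans NCw) // (le_trans (ler_norm _)) // lerDl.
by rewrite invfM mulrA divfK // gt_eqF.
Qed.

End Polynomials.

Definition forget_star (R : realType) (I : choiceType) (Q : starpoly R I) :
    ncpoly R I :=
  \sum_(w <- msupp Q) word (mcoeff w Q) [seq ib.1 | ib <- w].

(** On self-adjoint elements *-polynomials take no values beyond those of
    polynomials, so only the latter are considered below. *)
Lemma stareval_selfadjoint (R : realType) (I : choiceType) (A : starAlgType R)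
    (z : I -> A) (Q : starpoly R I) : (forall i, selfadjoint (z i)) ->
  stareval z Q = nceval z (forget_star Q).
Proof.
move=> z_sa; rewrite nceval_sum /stareval ncevalE; apply: eq_bigr => w _.
rewrite nceval_word big_map; congr (_ *: _).
by apply: eq_bigr => -[i []] _ //=; exact: z_sa.
Qed.

(** * Norms *)

Section CStarNorm.
Variables (R : realType) (A : cstarAlgType R).
Implicit Types a b : A.

Lemma cnorm0 : cnorm (0 : A) = 0.
Proof.
by rewrite -(scale0r (0 : A)) cnormZ ComplexField.Normc.normc0 mul0r.
Qed.

Lemma cnormN a : cnorm (- a) = cnorm a.
Proof. by rewrite -scaleN1r cnormZ normcN ComplexField.Normc.normc1 mul1r. Qed.

Lemma cnorm_ge0 a : 0 <= cnorm a.
Proof.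
by have := cnormD_le a (- a); rewrite cnormN subrr cnorm0; lra.
Qed.

Lemma cnorm_distC a b : cnorm (a - b) = cnorm (b - a).
Proof. by rewrite -cnormN opprB. Qed.

Lemma cnorm_triangle b a c : cnorm (a - c) <= cnorm (a - b) + cnorm (b - c).
Proof. by rewrite -[a - c](subrKA b) cnormD_le. Qed.

Lemma cnorm_star a : cnorm (star a) = cnorm a.
Proof.
have le_star b : cnorm b <= cnorm (star b).
  have [b0|b0] := eqVneq (cnorm b) 0; first by rewrite b0 cnorm_ge0.
  rewrite -(@ler_pM2r _ (cnorm b)) ?lt_def ?b0 ?cnorm_ge0 // -expr2 -cnorm_starM.
  exact: cnormM_le.
by apply/le_anti; rewrite le_star -{2}[a]starK le_star.
Qed.

(** The same approximants serve both orders of the product, as the trace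
    property requires. *)
Lemma cnorm_mul_approx a b : forall e, 0 < e ->
  exists2 h, 0 < h & forall p q, cnorm (a - p) < h -> cnorm (b - q) < h ->
    cnorm (a * b - p * q) < e /\ cnorm (b * a - q * p) < e.
Proof.
have mul_le h a' b' p q : h <= 1 -> cnorm (a' - p) < h -> cnorm (b' - q) < h ->
    cnorm (a' * b' - p * q) <= h * (cnorm a' + cnorm b' + 1).
  move=> h1 ap bq; rewrite -(subrKA (p * b')) -mulrBl -mulrBr.
  apply: le_trans (cnormD_le _ _) _.
  have pa : cnorm p <= cnorm a' + h.
    by have := cnormD_le a' (p - a'); rewrite subrKC cnorm_distC; lra.
  have := cnormM_le (a' - p) b'; have := cnormM_le p (b' - q).
  have := cnorm_ge0 (a' - p); have := cnorm_ge0 (b' - q).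
  have := cnorm_ge0 a'; have := cnorm_ge0 b'; have := cnorm_ge0 p; nra.
move=> e e0; set K := cnorm a + cnorm b + 1.
have K0 : 0 < K by rewrite ltr_wpDl // addr_ge0 ?cnorm_ge0.
exists (Num.min 1 (e / (2 * K))).
  by rewrite lt_min ltr01 divr_gt0 // mulr_gt0.
set h := Num.min _ _; have h1 : h <= 1 by rewrite ge_min lexx.
have hK : h * K < e.
  apply: (@le_lt_trans _ _ (e / (2 * K) * K)).
    by rewrite ler_pM2r // ge_min lexx orbT.
  by rewrite invfM mulrA divfK ?gt_eqF //; lra.
move=> p q ap bq; split; apply: le_lt_trans hK; first exact: mul_le.
by rewrite /K [cnorm a + _]addrC; exact: mul_le.
Qed.

(** The elements approximated by polynomials in self-adjoint generators form a
    closed *-subalgebra. *)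
Lemma nceval_dense (I : choiceType) (z : I -> A) :
  (forall i, selfadjoint (z i)) -> generates z ->
  forall a e, 0 < e -> exists Q : ncpoly R I, cnorm (a - nceval z Q) < e.
Proof.
move=> z_sa gen.
pose S := [set a | forall e : R, 0 < e ->
  exists Q : ncpoly R I, cnorm (a - nceval z Q) < e].
have evalS Q : S (nceval z Q) by move=> e e0; exists Q; rewrite subrr cnorm0.
suff ST : S = setT by move=> a; have : S a by rewrite ST.
apply: gen => [|a Sa e e0|u l Su ul e e0|i].
- have memS a : (a \in mem S) <-> S a by split=> [/set_mem|/mem_set].
  split=> [|c a b /memS Sa /memS Sb|a b /memS Sa /memS Sb]; apply/memS.
  + by rewrite -(nceval1 z); exact: evalS.
  + move=> e e0; have c0 : 0 < normc c + 1 by rewrite ltr_wpDl ?normc_ge0.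
    have e20 : 0 < e / 2 by rewrite divr_gt0.
    have [P aP] := Sa _ (divr_gt0 e20 c0); have [Q bQ] := Sb _ e20.
    exists (c *: P + Q); rewrite ncevalD ncevalZ opprD addrACA -scalerBr.
    apply: le_lt_trans (cnormD_le _ _) _; rewrite cnormZ.
    rewrite ltr_pdivlMr // in aP; have := cnorm_ge0 (a - nceval z P); nra.
  + move=> e e0; have [h h0 hP] := cnorm_mul_approx a b e0.
    have [P aP] := Sa h h0; have [Q bQ] := Sb h h0.
    by exists (P * Q); rewrite ncevalM; have [] := hP _ _ aP bQ.
- have [Q aQ] := Sa e e0; exists (ncstar Q).
  by rewrite nceval_star // -starB cnorm_star.
- have e20 : 0 < e / 2 by rewrite divr_gt0.
  have /cvgrPdist_lt/(_ _ e20)[k _ /(_ k (leqnn k))] /= := ul.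
  rewrite sub0r normrN ger0_norm ?cnorm_ge0 // => ulk.
  have [Q uQ] := Su k _ e20; exists Q.
  apply: le_lt_trans (cnorm_triangle (u k) _ _) _.
  by rewrite cnorm_distC; lra.
- have -> : z i = nceval z (word 1 [:: i]); last exact: evalS.
  by rewrite nceval_word big_seq1 scale1r.
Qed.

End CStarNorm.

Section MatrixNorm.
Variables (R : realType) (k : nat).
Implicit Types A B : 'M[R[i]]_k.+1.

Lemma opnorm1_le : opnorm (1 : 'M[R[i]]_k.+1) <= 1.
Proof. by apply: opnorm_le => // v; rewrite mul1mx mul1r. Qed.

Lemma opnorm_word (I : Type) (z : I -> 'M[R[i]]_k.+1) (r : R) (s : seq I) :
  0 <= r -> (forall i, opnorm (z i) <= r) ->
  opnorm (\prod_(i <- s) z i) <= r ^+ size s.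
Proof.
move=> r0 zr; elim: s => [|i s IHs]; first by rewrite big_nil opnorm1_le.
rewrite big_cons exprS; apply: (le_trans (opnormM _ _)).
by rewrite ler_pM ?opnorm_ge0.
Qed.

(** A diagonal entry is at most the norm of its column, which is the image of a
    unit vector. *)
Lemma normc_ntr_le A : normc (ntr A) <= opnorm A.
Proof.
have entry i : normc (A i i) <= opnorm A.
  have := l2norm_opnorm A (delta_mx i 0).
  have -> : l2norm (delta_mx i 0 : 'cV[R[i]]_k.+1) = 1.
    rewrite /l2norm (bigD1 i) //= big1 => [|j ji].
      by rewrite !mxE !eqxx ComplexField.Normc.normc1 expr1n addr0 sqrtr1.
    by rewrite !mxE (negPf ji) ComplexField.Normc.normc0 expr0n.
  rewrite mulr1 -colE; apply: le_trans.
  rewrite -[leLHS]ger0_norm ?normc_ge0 // -sqrtr_sqr /l2norm ler_sqrt; last first.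
    exact: sum_sqr_ge0.
  rewrite (bigD1 i) //= mxE lerDl; apply: sumr_ge0 => j _; exact: sqr_ge0.
have n0 : 0 < (k.+1%:R : R) by rewrite ltr0n.
have -> : ntr A = (k.+1%:R^-1)%:C%C * \tr A.
  by rewrite /ntr mulrC fmorphV rmorph_nat.
rewrite ComplexField.Normc.normcM normc_real ?invr_ge0 ?ler0n //.
rewrite [leLHS]mulrC ler_pdivrMr //; apply: (le_trans (le_normc_sum _ _)).
apply: (@le_trans _ _ (\sum_(i < k.+1) opnorm A)); first exact: ler_sum.
by rewrite sumr_const card_ord mulr_natr.
Qed.

End MatrixNorm.

(** * Limits along ultrafilters *)

Section ComplexNorm.
Variable R : realType.
Implicit Types (c : R[i]) (e : R).

Lemma normcB_sym (c c' : R[i]) : normc (c - c') = normc (c' - c).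
Proof. by rewrite -normcN opprB. Qed.

Lemma normc_triangle (c' c c'' : R[i]) :
  normc (c - c'') <= normc (c - c') + normc (c' - c'').
Proof. by rewrite -[c - c''](subrKA c') le_normcD. Qed.

Lemma Re_le_normc c : `|complex.Re c| <= normc c.
Proof.
case: c => a b /=; rewrite -sqrtr_sqr ler_sqrt ?addr_ge0 ?sqr_ge0 //.
by rewrite lerDl sqr_ge0.
Qed.

Lemma Im_le_normc c : `|complex.Im c| <= normc c.
Proof.
case: c => a b /=; rewrite -sqrtr_sqr ler_sqrt ?addr_ge0 ?sqr_ge0 //.
by rewrite lerDr sqr_ge0.
Qed.

Lemma normc_le_ReIm c : normc c <= `|complex.Re c| + `|complex.Im c|.
Proof.
have -> : c = (complex.Re c)%:C%C + 'i * (complex.Im c)%:C%C.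
  by case: c => a b; simpc.
apply: le_trans (le_normcD _ _) _.
rewrite ComplexField.Normc.normcM /= !expr0n /= !addr0 !add0r expr1n sqrtr1.
by rewrite !mul1r !mul0r !subr0 !sqrtr_sqr !addr0 ?add0r.
Qed.

Lemma eq_normc_lt c c' : (forall e, 0 < e -> normc (c - c') < e) -> c = c'.
Proof.
move=> cc'; apply/subr0_eq/ComplexField.Normc.eq0_normc/le_anti.
by rewrite normc_ge0 andbT leNgt; apply/negP => /cc'; rewrite ltxx.
Qed.

Lemma ge0_closed c :
  (forall e, 0 < e -> exists2 p : R[i], 0 <= p & normc (c - p) < e) -> 0 <= c.
Proof.
move=> cp; rewrite lecE /=.
have part e : 0 < e -> - e < complex.Re c /\ `|complex.Im c| < e.
  move=> /cp[p]; rewrite lecE /= => /andP[/eqP Ip Rp] cpe; split.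
    have := le_lt_trans (Re_le_normc _) cpe; rewrite raddfB /= ltr_norml.
    by move=> /andP[+ _]; lra.
  by have := le_lt_trans (Im_le_normc _) cpe; rewrite raddfB /= Ip subr0.
apply/andP; split.
  rewrite -normr_eq0; apply/eqP/le_anti; rewrite normr_ge0 andbT leNgt.
  by apply/negP => /part[_]; rewrite ltxx.
rewrite leNgt; apply/negP => c0.
have [|+ _] := part (- complex.Re c); first by rewrite oppr_gt0.
by rewrite opprK ltxx.
Qed.

End ComplexNorm.

Section UltraLimit.
Variables (R : realType) (T : Type) (U : set_system T).
Context {UU : UltraFilter U}.

(** A bounded function along an ultrafilter has a cluster point by compactness,
    and a cluster point of an ultrafilter is a limit. *)
Lemma ultra_limit_real (f : T -> R) (M : R) :
  (\forall t \near U, `|f t| <= M) ->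
  exists c, forall e, 0 < e -> \forall t \near U, `|c - f t| < e.
Proof.
move=> fM; have [c [_ fc]] : `[- M, M]%classic `&` cluster (f @ U) !=set0.
  apply: segment_compact; near=> t; rewrite /= in_itv /= -ler_norml.
  by near: t.
exists c => e e0.
have [//|notU] := in_ultra_setVsetC [set t | `|c - f t| < e] UU.
have [y [ney ye]] : [set y | e <= `|c - y|] `&` ball c e !=set0.
  apply: fc; last exact: nbhsx_ballx.
  by apply: filterS notU => t nt; rewrite /= leNgt; apply/negP; exact: nt.
by move: ney; rewrite /= leNgt => /negP[].
Unshelve. all: by end_near. Qed.

Lemma ultra_limit (f : T -> R[i]) (M : R) :
  (\forall t \near U, normc (f t) <= M) ->
  exists c, forall e, 0 < e -> \forall t \near U, normc (c - f t) < e.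
Proof.
move=> fM.
have [|a fa] := @ultra_limit_real (fun t => complex.Re (f t)) M.
  by apply: filterS fM => t; apply: le_trans; exact: Re_le_normc.
have [|b fb] := @ultra_limit_real (fun t => complex.Im (f t)) M.
  by apply: filterS fM => t; apply: le_trans; exact: Im_le_normc.
exists (Complex a b) => e e0; have e20 : 0 < e / 2 by rewrite divr_gt0.
apply: filterS2 (fa _ e20) (fb _ e20) => t ta tb.
apply: le_lt_trans (normc_le_ReIm _) _; rewrite !raddfB /=; lra.
Qed.

End UltraLimit.

(** The sets [D] that exhaust a member of [F] up to a small set form a proper
    filter, and any ultrafilter above it contains the complements of all small
    sets. *)
Lemma ultrafilter_avoiding (T : Type) (small : set T -> Prop)
    (F : set_system T) : Filter F ->
  small set0 -> (forall D D', D `<=` D' -> small D' -> small D) ->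
  (forall D D', small D -> small D' -> small (D `|` D')) ->
  (forall D, F D -> ~ small D) ->
  exists U : set_system T,
    [/\ UltraFilter U, F `<=` U & forall D, U D -> ~ small D].
Proof.
move=> FF small0 smallS smallU Fsmall.
pose G : set_system T := [set D | exists2 E, F E & small (E `\` D)].
have GG : ProperFilter G.
  apply: Build_ProperFilter_ex.
    move=> D [E FE ED]; apply: contrapT => D0; apply: (Fsmall E FE).
    by apply: smallS ED => t Et; split=> // Dt; apply: D0; exists t.
  split.
  - by exists setT; [exact: filterT|rewrite setDT].
  - move=> D D' [E FE ED] [E' FE' ED'].
    exists (E `&` E'); first exact: filterI.
    apply: smallS (smallU _ _ ED ED') => t [[Et E't] /not_andP[nD|nD']].
      by left.
    by right.
  - move=> D D' DD' [E FE ED]; exists E => //.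
    by apply: smallS ED => t [Et nD']; split=> // /DD'.
have [U [UU GU]] := ultraFilterLemma GG; exists U; split=> //.
  by move=> D FD; apply: GU; exists D => //; rewrite setDv.
move=> D UD sD; have /GU UnD : G (~` D).
  by exists setT; [exact: filterT|rewrite setTD setCK].
by have [t []] := filter_ex (filterI UD UnD).
Qed.

(** * The trace defined by a norm-preserving ultrafilter of matrix models *)

Section LimitTrace.
Variables (R : realType) (A : cstarAlgType R) (I : choiceType) (z : I -> A).
Hypotheses (z_sa : forall i, selfadjoint (z i)) (z_gen : generates z).
Variables (T : Type) (U : set_system T) (d : T -> nat).
Variable B : forall t, I -> 'M[R[i]]_((d t).+1).
Context {UU : UltraFilter U}.
Hypothesis B_sa : \forall t \near U, forall i, selfadjoint (B t i).
Hypothesis norm_lim : forall (Q : ncpoly R I) (e : R), 0 < e ->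
  \forall t \near U, `|opnorm (nceval (B t) Q) - cnorm (nceval z Q)| < e.
Implicit Types (a b : A) (c : R[i]) (e : R) (P Q : ncpoly R I).

(** The graph of the limit trace on polynomials, closed up in [A]: a point
    [(a, c)] is a limit of pairs formed by [Q(z)] and the limit trace of [Q].
    Extension by density thus amounts to showing that this relation is
    functional. *)
Definition trace_lim a c : Prop := forall e, 0 < e -> exists2 Q,
  cnorm (a - nceval z Q) < e &
  \forall t \near U, normc (c - ntr (nceval (B t) Q)) < e.

Lemma ntr_near0 Q e : cnorm (nceval z Q) < e ->
  \forall t \near U, normc (ntr (nceval (B t) Q)) < e.
Proof.
rewrite -subr_gt0 => Qe; apply: filterS (norm_lim Q Qe) => t.
rewrite ltr_norml => /andP[_ tQ].
by apply: le_lt_trans (normc_ntr_le _) _; lra.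
Qed.

(** As the matrix models preserve norms in the limit, normalized traces are
    asymptotically contractive; so any approximation of [a] by a polynomial
    may be used to compute its limit trace. *)
Lemma trace_lim_near a c Q e : trace_lim a c -> cnorm (a - nceval z Q) < e ->
  \forall t \near U, normc (c - ntr (nceval (B t) Q)) < e.
Proof.
move=> ac aQ; set h := (e - cnorm (a - nceval z Q)) / 2.
have h0 : 0 < h by rewrite divr_gt0 // subr_gt0.
have [P aP cP] := ac h h0.
have PQ : cnorm (nceval z (P - Q)) < h + cnorm (a - nceval z Q).
  rewrite ncevalB; apply: le_lt_trans (cnorm_triangle a _ _) _.
  by rewrite cnorm_distC ltrD2r.
apply: filterS2 cP (ntr_near0 PQ) => t cPt PQt.
apply: le_lt_trans (normc_triangle (ntr (nceval (B t) P)) _ _) _.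
move: PQt; rewrite ncevalB ntrB => PQt.
have -> : e = h + (h + cnorm (a - nceval z Q)) by rewrite /h; field.
exact: ltrD.
Qed.

Lemma trace_lim_uniq a c c' : trace_lim a c -> trace_lim a c' -> c = c'.
Proof.
move=> ac ac'; apply: eq_normc_lt => e e0.
have e20 : 0 < e / 2 by rewrite divr_gt0.
have [Q aQ] := nceval_dense z_sa z_gen a e20.
have [t [ct c't]] := filter_ex (filterI (trace_lim_near ac aQ)
  (trace_lim_near ac' aQ)).
apply: le_lt_trans (normc_triangle (ntr (nceval (B t) Q)) _ _) _.
rewrite [e]splitr; apply: ltrD; first exact: ct.
by rewrite normcB_sym; exact: c't.
Qed.

(** Two successive ultralimits: along [U] for each polynomial of a sequence
    approximating [a], then along that sequence, for an ultrafilter on its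
    indices. *)
Lemma trace_lim_ex a : exists c, trace_lim a c.
Proof.
have lim_poly Q : exists c, forall e, 0 < e ->
    \forall t \near U, normc (c - ntr (nceval (B t) Q)) < e.
  apply: (@ultra_limit _ _ _ _ _ (cnorm (nceval z Q) + 1)).
  have Q1 : cnorm (nceval z Q) < cnorm (nceval z Q) + 1 by rewrite ltrDl.
  by apply: filterS (ntr_near0 Q1) => t /ltW.
have [c0 c0P] := choice lim_poly.
have Qs j : exists Q, cnorm (a - nceval z Q) < j.+1%:R^-1.
  by apply: nceval_dense; rewrite ?invr_gt0 ?ltr0n.
have {Qs}[Qs QsP] := choice Qs.
have [V [VU ooV]] := ultraFilterLemma (eventually_filter : ProperFilter \oo).
have [|c cP] := @ultra_limit R _ V VU (fun j => c0 (Qs j)) (cnorm a + 2).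
  apply: nearW => j.
  have aQ : cnorm (nceval z (Qs j)) < cnorm a + 1.
    have := cnormD_le a (nceval z (Qs j) - a); rewrite subrKC.
    move=> /le_lt_trans; apply; rewrite ltrD2l cnorm_distC.
    by apply: lt_le_trans (QsP j) _; rewrite invf_le1 ?ltr0n // ler1n.
  have [t [ct Qt]] := filter_ex (filterI (c0P (Qs j) 1 ltr01) (ntr_near0 aQ)).
  have := normc_triangle (ntr (nceval (B t) (Qs j))) (c0 (Qs j)) 0.
  rewrite !subr0 => /le_trans; apply; apply/ltW.
  have -> : cnorm a + 2 = 1 + (cnorm a + 1) by ring.
  by apply: ltrD.
exists c => e e0; have e20 : 0 < e / 2 by rewrite divr_gt0.
have near_e : \forall j \near V, j.+1%:R^-1 < e.
  by apply: ooV; exact: near_infty_natSinv_lt (PosNum e0).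
have [j [cj je]] := filter_ex (filterI (cP _ e20) near_e).
exists (Qs j); first exact: lt_trans (QsP j) je.
apply: filterS (c0P (Qs j) _ e20) => t ct.
apply: le_lt_trans (normc_triangle (c0 (Qs j)) _ _) _.
by rewrite [e]splitr; apply: ltrD.
Qed.

Lemma trace_limP (c : R[i]) a b x y :
  trace_lim a x -> trace_lim b y -> trace_lim (c *: a + b) (c * x + y).
Proof.
move=> ax bY e e0; have c0 : 0 < normc c + 1 by rewrite ltr_wpDl ?normc_ge0.
have e20 : 0 < e / 2 by rewrite divr_gt0.
have [P aP Px] := ax _ (divr_gt0 e20 c0).
have [Q bQ Qy] := bY _ e20.
have split_e (u v u' : R) : 0 <= u -> u < e / 2 / (normc c + 1) ->
    v < e / 2 -> u' <= normc c * u + v -> u' < e.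
  move=> u0; rewrite ltr_pdivlMr // => uc v2 /le_lt_trans; apply; lra.
exists (c *: P + Q).
  apply: (split_e _ _ _ (cnorm_ge0 _) aP bQ).
  rewrite ncevalD ncevalZ opprD addrACA -scalerBr -cnormZ; exact: cnormD_le.
apply: filterS2 Px Qy => t Px Qy.
apply: (split_e _ _ _ (normc_ge0 _) Px Qy).
rewrite ncevalD ncevalZ ntrD ntrZ opprD addrACA -mulrBr.
by apply: le_trans (le_normcD _ _) _; rewrite ComplexField.Normc.normcM.
Qed.

Lemma limit_trace_ex : exists tau : {scalar A}, forall a, trace_lim a (tau a).
Proof.
have [tau tauP] := choice trace_lim_ex.
have tau_lin : GRing.linear_for *%R tau.
  move=> c a b; apply: (trace_lim_uniq (tauP _)).
  exact: trace_limP.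
pose tau_isLin := GRing.isLinear.Build R[i] A R[i] *%R tau tau_lin.
pose tau' : {scalar A} := HB.pack tau tau_isLin.
by exists tau'.
Qed.

Section Properties.
Variable tau : {scalar A}.
Hypothesis tauP : forall a, trace_lim a (tau a).

Lemma limit_trace_le a : normc (tau a) <= cnorm a.
Proof.
apply/ler_addgt0Pr => e e0.
have a0 : cnorm (a - nceval z (0 : ncpoly R I)) < cnorm a + e.
  by rewrite -[0](subrr 0) ncevalB subrr subr0 ltrDl.
have [t] := filter_ex (trace_lim_near (tauP a) a0).
rewrite -[0](subrr 0) ncevalB subrr.
by rewrite -[0](subrr 0) ntrB subrr subr0 => /ltW.
Qed.

(** Positivity, normalization and the trace property hold for normalized traces
    of matrices; they pass to the limit through polynomials approximating both
    factors of a product. *)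
Lemma limit_trace_tracial : tracial_state tau.
Proof.
split=> [a||a b].
- apply: ge0_closed => e e0.
  have [h h0 hP] := cnorm_mul_approx (star a) a e0.
  have [Q aQ] := nceval_dense z_sa z_gen a h0.
  have [|QQ _] := hP (nceval z (ncstar Q)) (nceval z Q) _ aQ.
    by rewrite nceval_star // -starB cnorm_star.
  rewrite -ncevalM in QQ.
  have [t [saB tQ]] := filter_ex (filterI B_sa (trace_lim_near (tauP _) QQ)).
  exists (ntr (nceval (B t) (ncstar Q * Q))); last exact: tQ.
  by rewrite ncevalM nceval_star // ntr_star_ge0.
- apply: (trace_lim_uniq (tauP 1)) => e e0; exists 1.
    by rewrite nceval1 subrr cnorm0.
  by apply: nearW => t; rewrite nceval1 ntr1 subrr ComplexField.Normc.normc0.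
- apply: eq_normc_lt => e e0; have e20 : 0 < e / 2 by rewrite divr_gt0.
  have [h h0 hP] := cnorm_mul_approx a b e20.
  have [P aP] := nceval_dense z_sa z_gen a h0.
  have [Q bQ] := nceval_dense z_sa z_gen b h0.
  have [PQ QP] := hP _ _ aP bQ; rewrite -!ncevalM in PQ QP.
  have [t [tPQ tQP]] := filter_ex (filterI (trace_lim_near (tauP _) PQ)
    (trace_lim_near (tauP _) QP)).
  apply: le_lt_trans (normc_triangle (ntr (nceval (B t) (P * Q))) _ _) _.
  rewrite [e]splitr; apply: ltrD; first exact: tPQ.
  by rewrite normcB_sym ncevalM ntrC -ncevalM; exact: tQP.
Qed.

End Properties.

End LimitTrace.

(** * From rational polynomials to all polynomials *)

Lemma seminorm_dist (R : realType) (V : zmodType) (N : V -> R) :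
  (forall a b, N (a + b) <= N a + N b) -> (forall a, N (- a) = N a) ->
  forall a b, `|N a - N b| <= N (a - b).
Proof.
move=> ND NN a b; have := ND b (a - b); have := ND a (b - a).
rewrite !subrKC -[N (b - a)]NN opprB ler_norml => h1 h2.
by apply/andP; split; lra.
Qed.

Lemma dist_lt3 (R : realType) (a b c c' u v e : R) :
  `|a - b| <= u -> `|c - c'| <= v -> u < e -> v < e -> `|c' - b| < e ->
  `|c - a| < e * 3.
Proof.
rewrite !ltr_norml !ler_norml => /andP[? ?] /andP[? ?] ? ? /andP[? ?].
by apply/andP; split; lra.
Qed.

Section Enumeration.
Variables (R : realType) (A : cstarAlgType R) (I : choiceType) (z : I -> A).
Variables (P : nat -> ncpoly R I) (r : R).
Hypotheses (P_enum : enumerates_rational_ncpoly P) (r_ge0 : 0 <= r).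
Implicit Types (Q : ncpoly R I) (e : R).

(** The bound [C] dominates the norms of words both at [z] and at every tuple
    of matrices of norm at most [r], so that one rational polynomial serves the
    algebra and all matrix models of all sizes simultaneously. *)
Lemma enumeration_dense Q e : 0 < e -> exists2 j,
  cnorm (nceval z Q - nceval z (P j)) < e &
  forall k (B : I -> 'M[R[i]]_k.+1), (forall i, opnorm (B i) <= r) ->
    opnorm (nceval B Q - nceval B (P j)) < e.
Proof.
move=> e0.
pose C (w : fmonom I) := cnorm (\prod_(i <- w) z i) + r ^+ size w.
have [Q' Q'rat Q'approx] := rational_approx Q C e0.
have [j _ jQ'] : range P Q' by rewrite P_enum.
exists j; rewrite jQ'.
  apply: Q'approx => [a b|c a|w]; first exact: cnormD_le.
    by rewrite cnormZ.
  by rewrite cnorm_ge0 lerDl exprn_ge0.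
move=> k B Br; apply: (Q'approx _ (@opnorm R k.+1)) => [a b|c a|w].
- exact: opnormD.
- exact: opnormZ_le.
- by rewrite opnorm_ge0 (le_trans (opnorm_word _ r_ge0 Br)) // lerDr cnorm_ge0.
Qed.

Lemma norm_close k (B : I -> 'M[R[i]]_k.+1) Q Q' e :
  cnorm (nceval z Q - nceval z Q') < e ->
  opnorm (nceval B Q - nceval B Q') < e ->
  `|opnorm (nceval B Q') - cnorm (nceval z Q')| < e ->
  `|opnorm (nceval B Q) - cnorm (nceval z Q)| < e * 3.
Proof.
move=> qe Xe; apply: dist_lt3 qe Xe.
  exact: (seminorm_dist (@cnormD_le _ A) (@cnormN _ A)).
exact: (seminorm_dist (@opnormD R k.+1) (@opnormN R k.+1)).
Qed.

End Enumeration.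

Section MFTrace.
Variables (R : realType) (A : cstarAlgType R) (N : nat) (z : 'I_N -> A).
Variables (P : nat -> ncpoly R 'I_N) (r : R).
Hypotheses (P_enum : enumerates_rational_ncpoly P) (r_ge0 : 0 <= r).
Hypotheses (z_sa : forall i, selfadjoint (z i)).
Variables (T : Type) (U : set_system T) (d : T -> nat).
Variable B : forall t, 'I_N -> 'M[R[i]]_((d t).+1).
Context {UU : UltraFilter U}.
Hypothesis B_sa : \forall t \near U, forall i, selfadjoint (B t i).
Hypothesis B_le : \forall t \near U, forall i, opnorm (B t i) <= r.
Hypothesis P_lim : forall j (e : R), 0 < e ->
  \forall t \near U,
    `|opnorm (nceval (B t) (P j)) - cnorm (nceval z (P j))| < e.

(** Convergence of norms is only assumed for the rational polynomials, but the
    approximation in [enumeration_dense] is uniform over the models. *)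
Lemma norm_lim_all (Q : ncpoly R 'I_N) (e : R) : 0 < e ->
  \forall t \near U, `|opnorm (nceval (B t) Q) - cnorm (nceval z Q)| < e.
Proof.
move=> e0; have e30 : 0 < e / 3 by rewrite divr_gt0.
have [j zj Bj] := enumeration_dense z P_enum r_ge0 Q e30.
apply: filterS2 B_le (P_lim j e30) => t Bt Pt.
rewrite -[e](divfK (_ : 3 != 0)) ?pnatr_eq0 //.
exact: norm_close zj (Bj _ _ Bt) Pt.
Qed.

(** Choosing, for each [q], a matrix model that is good for the first [q]
    rational polynomials turns limits along the ultrafilter into limits of a
    sequence. *)
Lemma limit_trace_MF (tau : {scalar A}) : tracial_state tau ->
  (forall a, trace_lim z U B a (tau a)) -> MF_traces z tau.
Proof.
move=> tau_tr tauP; split=> //.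
have tau_le a : normc (tau a) <= cnorm a.
  by apply: limit_trace_le tauP _; exact: norm_lim_all.
have good q : exists t, [/\ forall i, selfadjoint (B t i),
    forall i, opnorm (B t i) <= r & forall j : 'I_q,
    `|opnorm (nceval (B t) (P j)) - cnorm (nceval z (P j))| < q.+1%:R^-1 /\
    normc (tau (nceval z (P j)) - ntr (nceval (B t) (P j))) < q.+1%:R^-1].
  have q0 : 0 < q.+1%:R^-1 :> R by rewrite invr_gt0 ltr0n.
  apply: (@filter_ex _ U); apply: filterS3 B_sa B_le _ => [t sa le Pj|].
    by split; [exact: sa|exact: le|exact: Pj].
  apply: filter_forall => j; apply: filterI; first exact: P_lim.
  by apply: (trace_lim_near norm_lim_all (tauP _)); rewrite subrr cnorm0.
have {good}[t tP] := choice good.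
exists (fun q => d (t q)), (fun q => B (t q)) => Q.
set Q' := forget_star Q.
have Q'E q : stareval (B (t q)) Q = nceval (B (t q)) Q'.
  by have [sa _ _] := tP q; exact: stareval_selfadjoint.
rewrite (stareval_selfadjoint Q z_sa) -/Q'.
have near_Q' (e : R) : 0 < e -> \forall q \near \oo,
    `|opnorm (nceval (B (t q)) Q') - cnorm (nceval z Q')| < e * 3 /\
    normc (tau (nceval z Q') - ntr (nceval (B (t q)) Q')) < e * 3.
  move=> e0; have [j zj Bj] := enumeration_dense z P_enum r_ge0 Q' e0.
  near=> q; have [_ le /(_ (Ordinal (_ : (j < q)%N)))] := tP q.
  have jq : (j < q)%N by near: q; exact: nbhs_infty_gt.
  move=> /(_ jq) /= [norm_j tr_j].
  have qe : q.+1%:R^-1 < e by near: q; exact: near_infty_natSinv_lt (PosNum e0).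
  have {}Bj := Bj _ _ le; split.
    exact: norm_close zj Bj (lt_trans norm_j qe).
  apply: le_lt_trans (normc_triangle (tau (nceval z (P j))) _ _) _.
  have -> : e * 3 = e + (e + e) by ring.
  apply: ltrD; first by rewrite -linearB; exact: le_lt_trans (tau_le _) zj.
  apply: le_lt_trans (normc_triangle (ntr (nceval (B (t q)) (P j))) _ _) _.
  apply: ltrD; first exact: lt_trans tr_j qe.
  by rewrite normcB_sym -ntrB; exact: le_lt_trans (normc_ntr_le _) Bj.
split; apply/cvgrPdist_lt => e e0.
  have e30 : 0 < e / 3 by rewrite divr_gt0.
  apply: filterS (near_Q' _ e30) => q [+ _].
  by rewrite Q'E divfK ?pnatr_eq0 // distrC.
have e30 : 0 < e / 3 by rewrite divr_gt0.
apply: filterS (near_Q' _ e30) => q [_ +].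
rewrite Q'E divfK ?pnatr_eq0 // sub0r normrN ger0_norm ?normc_ge0 //.
by rewrite normcB_sym.
Unshelve. all: by end_near. Qed.

End MFTrace.

(** * Comparison of the two orbit dimensions *)

Lemma limf_esup_ge (R : realType) (f : R -> \bar R) (w : R) (a : \bar R) :
  0 < w -> (forall w', 0 < w' -> w' <= w -> (a <= f w')%E) ->
  (a <= limf_esup f 0^'+)%E.
Proof.
move=> w0 fa; apply: le_ereal_inf_tmp => _ [V FV <-].
have [w' [Vw' w'0 w'w]] : exists w', [/\ V w', 0 < w' & w' <= w].
  apply: (@filter_ex _ (0^'+ : set_system R)); near=> w'; split.
  - by near: w'.
  - by near: w'; exact: nbhs_right_gt.
  - by near: w'; exact: nbhs_right_le.
by apply: le_ereal_sup_tmp; exists (f w'); [exists w'|exact: fa].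
Unshelve. all: by end_near. Qed.

Section MatrixModels.
Variables (R : realType) (A : cstarAlgType R) (n m : nat).
Variables (x : 'I_n -> A) (y : 'I_m -> A) (P : nat -> ncpoly R 'I_(n + m)).

Definition model : Type :=
  {k : nat & (('I_n -> 'M[R[i]]_k.+1) * ('I_m -> 'M[R[i]]_k.+1))%type}.

Definition model_tuple (t : model) : 'I_(n + m) -> 'M[R[i]]_((tag t).+1) :=
  fcat (tagged t).1 (tagged t).2.

Definition model_proj (D : set model) k : set ('I_n -> 'M[R[i]]_k.+1) :=
  [set X | exists Y, D (Tagged _ (X, Y))].
Arguments model_proj : clear implicits.

(** [Gamma_top] consists of the first components of these models; the second
    components are kept because the traces of words involve them. *)
Definition norm_models (r0 : R) (er : R * nat) : set model := [set t |
  (forall i, selfadjoint (model_tuple t i) /\ opnorm (model_tuple t i) <= r0) /\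
  forall j, (j < er.2)%N -> `|opnorm (nceval (model_tuple t) (P j)) -
    cnorm (nceval (fcat x y) (P j))| <= er.1].

Lemma norm_models_filter r0 :
  Filter (filter_from [set er : R * nat | 0 < er.1] (norm_models r0)).
Proof.
apply: filter_from_filter; first by exists (1, 0%N) => /=.
move=> [e r] [e' r'] /= e0 e'0; exists (Num.min e e', maxn r r').
  by rewrite /= lt_min e0 e'0.
move=> t [sa tP]; split; split=> // j jr; have /= := tP j.
  by rewrite leq_max jr => /(_ isT) /le_trans; apply; rewrite ge_min lexx.
rewrite leq_max jr orbT => /(_ isT) /le_trans; apply.
by rewrite ge_min lexx orbT.
Qed.

(** If no set [Gamma_top] is slow, then an ultrafilter of models avoiding the
    slow families defines an MF-trace.  Its microstates contain the projection
    of a member of that ultrafilter, for every choice of [p] and [e], because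
    they are cut out by finitely many words. *)
Lemma K2_ge_of_models (w r0 alpha : R) : 0 < w -> 0 < r0 ->
  (forall i, selfadjoint (x i)) -> (forall j, selfadjoint (y j)) ->
  generates (fcat x y) -> enumerates_rational_ncpoly P ->
  (forall er, 0 < er.1 ->
    ~ slow (w / 2) alpha (@Gamma_top R A n m x y P r0 er.1 er.2)) ->
  exists2 tau : {scalar A}, MF_traces (fcat x y) tau &
    (alpha%:E <= K2 x y tau)%E.
Proof.
move=> w0 r00 x_sa y_sa xy_gen P_enum Gamma_top_fast.
pose small (D : set model) := slow (w / 2) alpha (model_proj D).
have [||||U [UU FU Usmall]] := ultrafilter_avoiding
    (small := small) (norm_models_filter r0).
- by apply: slow0 => k; rewrite -subset0 => X [].
- by move=> D D' DD'; apply: slowS => k X [Y DXY]; exists Y; exact: DD'.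
- move=> D D' sD sD'; apply: slowS (slowU sD sD') => k X [Y [DY|D'Y]].
    by left; exists Y.
  by right; exists Y.
- move=> D [er er0 erD] sD; apply: (Gamma_top_fast er er0).
  by apply: slowS sD => k X [Y XY]; exists Y; apply: erD.
have z_sa i : selfadjoint (fcat x y i).
  by rewrite /fcat; case: fintype.split.
have U_norm e r : 0 < e -> \forall t \near U, norm_models r0 (e, r) t.
  by move=> e0; apply: FU; exists (e, r).
have U_sa : \forall t \near U, forall i, selfadjoint (model_tuple t i).
  by apply: filterS (U_norm 1 0%N ltr01) => t [sa _] i; have [] := sa i.
have U_le : \forall t \near U, forall i, opnorm (model_tuple t i) <= r0.
  by apply: filterS (U_norm 1 0%N ltr01) => t [sa _] i; have [] := sa i.
have U_lim j (e : R) : 0 < e -> \forall t \near U,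
    `|opnorm (nceval (model_tuple t) (P j)) -
      cnorm (nceval (fcat x y) (P j))| < e.
  move=> e0; have e20 : 0 < e / 2 by rewrite divr_gt0.
  apply: filterS (U_norm (e / 2) j.+1 e20) => t [_ /(_ j (ltnSn j)) /= tj].
  by apply: le_lt_trans tj _; rewrite ltr_pdivrMr // ltr_pMr // ltr1n.
have all_lim (Q : ncpoly R 'I_(n + m)) (e : R) : 0 < e -> \forall t \near U,
    `|opnorm (nceval (model_tuple t) Q) - cnorm (nceval (fcat x y) Q)| < e.
  exact: (norm_lim_all P_enum (ltW r00) U_le U_lim).
have [tau tauP] := limit_trace_ex (UU := UU) z_sa xy_gen all_lim.
exists tau.
  apply: (limit_trace_MF P_enum (ltW r00) z_sa U_sa U_le U_lim) => //.
  exact: (limit_trace_tracial z_sa xy_gen U_sa all_lim).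
have w20 : 0 < w / 2 by rewrite divr_gt0.
(* Radii below [w / 2] suffice, as a covering by smaller balls is a covering by
   balls of radius [w / 2]. *)
apply: (limf_esup_ge w20) => w' w'0 w'w.
apply: le_ereal_sup_tmp; eexists; first by exists r0; [exact: r00|reflexivity].
apply: le_ereal_inf_tmp => _ [[p e] /= e0 <-].
rewrite leNgt; apply/negP => /growth_slow [b ba slow_b].
pose D : set model := [set t | (forall i, selfadjoint (model_tuple t i) /\
    opnorm (model_tuple t i) <= r0) /\
  forall s : seq 'I_(n + m), (1 <= size s <= p)%N ->
    normc (ntr (\prod_(i <- s) model_tuple t i) -
           tau (\prod_(i <- s) fcat x y i)) < e].
apply: (Usmall D); last first.
  exists b => //; apply: filterS slow_b => k [K cK bK]; exists K => //.
  by apply: coverableS cK => // X [Y XY]; exists Y.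
apply: filterS2 (U_norm 1 0%N ltr01) _ => [t [sa _] tr|].
  by split; [exact: sa|exact: tr].
have word_near (s : seq 'I_(n + m)) : \forall t \near U,
    normc (ntr (\prod_(i <- s) model_tuple t i) -
           tau (\prod_(i <- s) fcat x y i)) < e.
  have s0 : cnorm (\prod_(i <- s) fcat x y i -
      nceval (fcat x y) (word 1 s)) < e.
    by rewrite nceval_word scale1r subrr cnorm0.
  apply: filterS (trace_lim_near (UU := UU) all_lim (tauP _) s0) => t.
  by rewrite nceval_word scale1r normcB_sym.
have : \forall t \near U, forall (q : 'I_p.+1) (s : q.-tuple 'I_(n + m)),
    normc (ntr (\prod_(i <- s) model_tuple t i) -
           tau (\prod_(i <- s) fcat x y i)) < e.
  by apply: filter_forall => q; apply: filter_forall => s; exact: word_near.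
apply: filterS => t tr s /andP[_ sp].
exact: (tr (Ordinal (sp : (size s < p.+1)%N)) (in_tuple s)).
Qed.

End MatrixModels.

Theorem theorem5 (R : realType) (A : cstarAlgType R) (n m : nat)
    (x : 'I_n -> A) (y : 'I_m -> A)
    (P : nat -> ncpoly R 'I_(n + m))
    (A_MF : MF_algebra A)
    (x_sa : forall i, selfadjoint (x i))
    (y_sa : forall j, selfadjoint (y j))
    (xy_gen : generates (fcat x y))
    (P_enum : enumerates_rational_ncpoly P) :
  (K_top x y P <=
   ereal_sup [set K2 x y tau | tau in MF_traces (fcat x y)])%E.
Proof.
set S := (X in (_ <= X)%E).
apply: ge_ereal_sup => _ [w w0 <-]; apply: ge_ereal_sup => _ [r0 r00 <-].
set L := ereal_inf _; rewrite leNgt; apply/negP => SL.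
(* Both bounds may be infinite, but a real number separates them. *)
have [alpha Salpha alphaL] : exists2 alpha : R,
    (S < alpha%:E)%E & (alpha%:E <= L)%E.
  move: S L SL => [s| |] [l| |] // SL.
  - by exists l.
  - by exists (s + 1); rewrite ?leey // lte_fin ltrDl.
  - by exists l; rewrite ?ltNyr.
  - by exists 0; rewrite ?ltNyr ?leey.
have [er er0 slow_er|tau tauMF] :=
  @K2_ge_of_models R A n m x y P w r0 alpha w0 r00 x_sa y_sa xy_gen P_enum.
  have := slow_growth w0 slow_er; rewrite ltNge => /negP; apply.
  by apply: le_trans alphaL _; apply: ereal_inf_lbound; exists er.
rewrite leNgt => /negP; apply; apply: le_lt_trans Salpha.
by apply: ereal_sup_ubound; exists tau.
Qed.
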